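(* Let $\varphi: M^2 \to N^4(\epsilon)$ be a non-CMC W-surface with flat normal bundle. Assume that $3 f^2 + K - \epsilon \neq 0$ and $\nabla^\perp E_3 \neq 0$ at any point. If $M$ satisfies $A_3 (\operatorname{grad} f) = 2 f \operatorname{grad} f$, then it cannot be biharmonic.
   Context: $N^4(\epsilon)$, $\epsilon\in\mathbb R$, is the 4-dimensional space form (complete, simply connected) of constant sectional curvature $\epsilon$. Manifolds are connected and immersions are isometric. For a surface $\varphi:M^2\to N^4(\epsilon)$: $B$ is the second fundamental form, $A_\eta$ the shape operator in the normal direction $\eta$, $\nabla^\perp$ the normal connection, $\Delta^\perp=-\operatorname{trace}(\nabla^\perp\nabla^\perp-\nabla^\perp_\nabla)$, $H=\frac12\operatorname{trace}B$, $f=|H|$, $K$ the Gaussian curvature, $E_3=H/f$, $A_3=A_{E_3}$. Flat normal bundle means the curvature of $\nabla^\perp$ vanishes. The surface is biharmonic (vanishing bitension field) if and only if $2\operatorname{trace}A_{\nabla^\perp_{(\cdot)}H}(\cdot)+\operatorname{grad}|H|^2=0$ and $\Delta^\perp H+\operatorname{trace}B(\cdot,A_H(\cdot))-2\epsilon H=0$. A W-surface is one for which there is a smooth $W:\mathbb R^2\to\mathbb R$ with nowhere zero gradient such that $W(f,K)=0$ on $M$. ''Non-CMC'' here means $H\neq0$, $\operatorname{grad}f\neq0$ and $A_3\neq f\,\mathrm{Id}$ at every point. *)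

(* Defs.v *)
From HB Require Import structures.
From mathcomp Require Import all_boot all_order all_algebra.
From mathcomp Require Import all_classical all_reals all_analysis.

Set Implicit Arguments.
Unset Strict Implicit.
Unset Printing Implicit Defensive.

Import Order.TTheory GRing.Theory Num.Theory.
Import numFieldNormedType.Exports.

Local Open Scope classical_set_scope.
Local Open Scope ring_scope.

Section Smoothness.
Context {R : realType}.

Definition partial {n : nat} {V : normedModType R} (i : 'I_n.+1)
    (F : 'rV[R]_n.+1 -> V) : 'rV[R]_n.+1 -> V :=
  fun u => 'D_(delta_mx 0 i) F u.

(* C^infinity on an open set [U]: every iterated partial derivative is
   differentiable at every point of [U]. *)
Definition smooth_on {n : nat} {V : normedModType R} (U : set 'rV[R]_n.+1)
    (F : 'rV[R]_n.+1 -> V) : Prop :=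
  forall (s : seq 'I_n.+1) (u : 'rV[R]_n.+1), U u ->
    differentiable (foldr partial F s) u.

End Smoothness.

Section Surfaces.
Context {R : realType}.

(* [cmap] and [cinv] are total functions; only their values on [cdom] and
   [cimg] respectively are meaningful. *)
Record chart (M : topologicalType) := Chart {
  cdom : set M;
  cimg : set 'rV[R]_2;
  cmap : M -> 'rV[R]_2;
  cinv : 'rV[R]_2 -> M;
  cdom_open : open cdom;
  cimg_open : open cimg;
  cmap_img : forall x, cdom x -> cimg (cmap x);
  cinv_dom : forall u, cimg u -> cdom (cinv u);
  cmapK : forall x, cdom x -> cinv (cmap x) = x;
  cinvK : forall u, cimg u -> cmap (cinv u) = u;
  cmap_continuous : forall x, cdom x -> {for x, continuous cmap};
  cinv_continuous : forall u, cimg u -> {for u, continuous cinv}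
}.

Definition smooth_atlas (M : topologicalType) (A : set (chart M)) : Prop :=
  (forall x : M, exists2 c, A c & cdom c x) /\
  (forall c d, A c -> A d ->
     smooth_on (cimg c `&` cinv c @^-1` cdom d) (cmap d \o cinv c)).

Definition connected_surface (M : topologicalType) (A : set (chart M)) : Prop :=
  [/\ [set: M] !=set0, connected [set: M], hausdorff_space M,
      @second_countable M & smooth_atlas A].

End Surfaces.
Arguments chart R M : clear implicits.

(* The space form of curvature [eps] as a hypersurface of [R^5]: the sphere
   [<x, x> = 1/eps] of Euclidean space if [0 < eps], the hyperplane [x_0 = 0] of
   Euclidean space if [eps = 0], and the upper sheet of the hyperboloid
   [<x, x> = 1/eps] of Minkowski space if [eps < 0]. *)
Section SpaceForm.
Context {R : realType}.
Implicit Types (eps : R) (x v w : 'rV[R]_5).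

Definition ip eps v w : R :=
  \sum_(a < 5) (if (eps < 0) && (a == 0) then -1 else 1) * (v 0 a * w 0 a).

Definition space_form eps : set 'rV[R]_5 :=
  [set x : 'rV[R]_5 | if eps == 0 then x 0 0 = 0
           else eps * ip eps x x = 1 /\ (eps < 0 -> 0 < x 0 0)].

Definition tangent_space eps x : set 'rV[R]_5 :=
  [set v : 'rV[R]_5 | if eps == 0 then v 0 0 = 0 else ip eps v x = 0].

(* Orthogonal projection onto [tangent_space eps x], for [x] in the space form
   and, when [eps = 0], [v] already in the hyperplane. *)
Definition tangent_proj eps x v : 'rV[R]_5 := v - (eps * ip eps v x) *: x.

(* [R(v, w) z] for constant sectional curvature [eps], with the convention
   [R(X, Y) = [nabla_X, nabla_Y] - nabla_[X, Y]]. *)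
Definition space_form_curvature eps v w z : 'rV[R]_5 :=
  eps *: (ip eps w z *: v - ip eps v z *: w).

End SpaceForm.

(* Geometry of a local parametrization [F] of a surface in the space form, at
   the parameter [u]. The surface carries the induced metric. Tangent vectors
   of the surface are row vectors in the coordinate frame, and endomorphisms
   act on them by right multiplication. Sections of the pull-back of the
   tangent bundle of the space form are [R^5]-valued functions. *)
Section LocalGeometry.
Context {R : realType}.
Variables (eps : R) (F : 'rV[R]_2 -> 'rV[R]_5).
Implicit Types (u : 'rV[R]_2) (V : 'rV[R]_2 -> 'rV[R]_5) (i j k l : 'I_2).

Local Notation "<< v , w >>" := (ip eps v w).

Definition metric u : 'M[R]_2 :=
  \matrix_(i, j) << partial i F u, partial j F u >>.

Definition cometric u : 'M[R]_2 := invmx (metric u).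

(* [nabla_{d_i} d_j = \sum_k (christoffel k i j) d_k] *)
Definition christoffel k i j u : R :=
  2^-1 * \sum_l cometric u k l *
    (partial i (fun w => metric w j l : R^o) u
     + partial j (fun w => metric w i l : R^o) u
     - partial l (fun w => metric w i j : R^o) u).

(* [R(d_i, d_j) d_k = \sum_l (riemann l i j k) d_l] *)
Definition riemann l i j k u : R :=
  partial i (fun w => christoffel l j k w : R^o) u
  - partial j (fun w => christoffel l i k w : R^o) u
  + \sum_m (christoffel l i m u * christoffel m j k u
            - christoffel l j m u * christoffel m i k u).

Definition gauss_curvature u : R :=
  (\sum_l riemann l 0 1 1 u * metric u l 0) / \det (metric u).

Definition pullback_nabla i V u : 'rV[R]_5 :=
  tangent_proj eps (F u) (partial i V u).

Definition rough_laplacian V u : 'rV[R]_5 :=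
  - \sum_i \sum_j cometric u i j *:
      (pullback_nabla i (pullback_nabla j V) u
       - \sum_k christoffel k i j u *: pullback_nabla k V u).

Definition second_fundamental_form i j u : 'rV[R]_5 :=
  pullback_nabla i (partial j F) u
  - \sum_k christoffel k i j u *: partial k F u.

Definition tension u : 'rV[R]_5 :=
  \sum_i \sum_j cometric u i j *: second_fundamental_form i j u.

Definition bitension u : 'rV[R]_5 :=
  - rough_laplacian tension u
  - \sum_i \sum_j cometric u i j *:
      space_form_curvature eps (partial i F u) (tension u) (partial j F u).

Definition mean_curvature_vector u : 'rV[R]_5 := 2^-1 *: tension u.

Definition mean_curvature u : R :=
  Num.sqrt << mean_curvature_vector u, mean_curvature_vector u >>.

Definition E3 u : 'rV[R]_5 :=
  (mean_curvature u)^-1 *: mean_curvature_vector u.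

Definition shape_operator (eta : 'rV[R]_5) u : 'M[R]_2 :=
  \matrix_(i, k)
    \sum_j << second_fundamental_form i j u, eta >> * cometric u j k.

Definition A3 u : 'M[R]_2 := shape_operator (E3 u) u.

Definition grad (h : 'rV[R]_2 -> R) u : 'rV[R]_2 :=
  \row_k \sum_i partial i (h : _ -> R^o) u * cometric u i k.

(* Orthogonal projection onto the normal space, for [v] tangent to the space
   form at [F u]. *)
Definition normal_proj u (v : 'rV[R]_5) : 'rV[R]_5 :=
  v - \sum_i \sum_j (cometric u i j * << v, partial i F u >>) *: partial j F u.

Definition normal_nabla i V u : 'rV[R]_5 :=
  normal_proj u (pullback_nabla i V u).

Definition smooth_normal_section (U : set 'rV[R]_2) V : Prop :=
  smooth_on U V /\
  forall u, U u -> tangent_space eps (F u) (V u) /\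
                   (forall i, << V u, partial i F u >> = 0).

End LocalGeometry.

Section ImmersedSurfaces.
Context {R : realType} {M : topologicalType}.
Variables (eps : R) (A : set (chart R M)) (phi : M -> 'rV[R]_5).

Definition immersion : Prop :=
  (forall p, space_form eps (phi p)) /\
  forall c, A c ->
    smooth_on (cimg c) (phi \o cinv c) /\
    forall u, cimg c u -> injective ('d (phi \o cinv c) u).

Definition everywhere (P : ('rV[R]_2 -> 'rV[R]_5) -> 'rV[R]_2 -> Prop) : Prop :=
  forall c, A c -> forall u, cimg c u -> P (phi \o cinv c) u.

Definition non_cmc : Prop :=
  everywhere (fun F u =>
    [/\ mean_curvature_vector eps F u <> 0,
        grad eps F (mean_curvature eps F) u <> 0 &
        A3 eps F u <> (mean_curvature eps F u)%:M]).

Definition W_surface : Prop :=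
  exists W : 'rV[R]_2 -> R^o,
    [/\ smooth_on [set: 'rV[R]_2] W,
        (forall x, exists i, partial i W x <> 0) &
        everywhere (fun F u =>
          W (\row_i (if i == 0 then mean_curvature eps F u
                     else gauss_curvature eps F u)) = 0)].

(* The coordinate fields commute, so the curvature of the normal connection is
   the commutator of the covariant derivatives along them. *)
Definition flat_normal_bundle : Prop :=
  forall c, A c -> forall eta,
    let F := phi \o cinv c in
    smooth_normal_section eps F (cimg c) eta ->
    forall i j u, cimg c u ->
      normal_nabla eps F i (normal_nabla eps F j eta) u
      = normal_nabla eps F j (normal_nabla eps F i eta) u.

Definition biharmonic : Prop := everywhere (fun F u => bitension eps F u = 0).

End ImmersedSurfaces.

(* Main.v *)
Require Import Defs.
From HB Require Import structures.
From mathcomp Require Import all_boot all_order all_algebra.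
From mathcomp Require Import all_classical all_reals all_analysis.
From mathcomp Require Import ring lra.
Import Order.TTheory GRing.Theory Num.Theory.
Import numFieldNormedType.Exports.
Local Open Scope classical_set_scope.
Local Open Scope ring_scope.

Set Implicit Arguments.
Unset Strict Implicit.
Unset Printing Implicit Defensive.

(** Let [f = |H|] and let [e_1], [e_2] be the orthonormal frame with [e_1]
    parallel to [grad f], on any chart. The shape operator of [H] has the
    eigenvalues [2 f^2] and, by its trace, [0]. Flatness of the normal bundle
    (the Ricci equation tested on [H]) then kills [B(e_1, e_2)], so that
    [B(e_1, e_1) = 2 H + W] and [B(e_2, e_2) = - W] for a normal field [W]
    orthogonal to [H]. Put [s = |H|^2], [A = |W|^2], [p = e_1(s)], and let [al]
    and [be] be the values of the connection form of the frame on [e_1] and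
    [e_2].

    The Codazzi equations and the tangent part of the biharmonic equation give
    [al = 0] and [4 be s = - 3 p]; hence [W] is nowhere zero, [H] and [W] span
    the normal bundle, [H] is parallel along [e_2], and [s], [A], [p] obey
    ordinary differential equations along [e_1]. With [p = 4 tau s], the
    [W]-component of the biharmonic equation reads [3 tau' = 9 tau^2 - A]; the
    Gauss equation reads [3 tau' = 9 tau^2 - A + eps], which forces [eps = 0].
    The [H]-component is then the algebraic relation
    [6 tau^2 A - A^2 - 6 s A - 54 tau^2 s = 0]. Its derivative along [e_1] is a
    second relation linear in [tau^2], and eliminating [tau^2] leaves
    [A = 21 s]. But [A' = 12 tau A] while [s' = 4 tau s], so [tau = 0],
    against [grad f <> 0].

    All of this is an identity-chasing argument with two derivations. It is
    therefore carried out in an abstract commutative ring with commuting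
    derivations, where smoothness is never an issue
    ([adapted_frame_absurd], [surface_absurd]). The ring is then instantiated
    with the smooth functions on the image of a chart: closure under inverses
    and square roots makes the frame available, [clairaut] makes the partial
    derivatives commute, and [ip_gt0], the positivity of the metric on tangent
    vectors of the space form, makes the relevant functions invertible. The
    space form lies in the flat space [R^5], so only flat derivatives
    of [R^5]-valued functions occur, and the Gauss, Codazzi and Ricci equations
    are instances of the symmetry of second derivatives. *)

(** * Derivations and inner products over a commutative ring *)

Section Derivations.
Variable S : comPzRingType.
Implicit Types (D : S -> S) (x y z a b c l r : S).

Definition derivation D :=
  (forall x y, D (x + y) = D x + D y) /\
  (forall x y, D (x * y) = D x * y + x * D y).

(** A predicate on a mere [comPzRingType], because the ring of smooth functions on
    an open set is trivial when the set is empty. *)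
Definition invertible x := exists y, x * y = 1.

Lemma invertible_cancel x y z : invertible x -> x * y = x * z -> y = z.
Proof.
case=> t xt E; have txK w : w = t * (x * w) by rewrite mulrA (mulrC t) xt mul1r.
by rewrite (txK y) E -txK.
Qed.

Lemma invertible_cancel0 x y : invertible x -> x * y = 0 -> y = 0.
Proof. by move=> xI E; apply: (invertible_cancel xI); rewrite E mulr0. Qed.

Lemma invertibleM x y : invertible x -> invertible y -> invertible (x * y).
Proof.
by case=> t xt [t' yt]; exists (t * t'); rewrite mulrACA xt yt mulr1.
Qed.

Lemma invertibleN x : invertible x -> invertible (- x).
Proof. by case=> t xt; exists (- t); rewrite mulrNN. Qed.

Lemma invertible_factor x y : invertible (x * y) -> invertible y.
Proof. by case=> t xyt; exists (x * t); rewrite mulrCA mulrA. Qed.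

(** An equation holds as soon as the difference of its sides is a linear
    combination of known equations; the remaining identity suits [ring]. *)
Lemma lin_comb1 a b c l r : l = r -> a - b = c * (l - r) -> a = b.
Proof. by move=> -> /eqP; rewrite subrr mulr0 subr_eq0 => /eqP. Qed.

Lemma lin_comb2 a b c l r (c' l' r' : S) : l = r -> l' = r' ->
  a - b = c * (l - r) + c' * (l' - r') -> a = b.
Proof. by move=> -> -> /eqP; rewrite !subrr !mulr0 addr0 subr_eq0 => /eqP. Qed.

Lemma lin_comb3 a b c l r (c' l' r' c'' l'' r'' : S) :
  l = r -> l' = r' -> l'' = r'' ->
  a - b = c * (l - r) + c' * (l' - r') + c'' * (l'' - r'') -> a = b.
Proof.
by move=> -> -> -> /eqP; rewrite !subrr !mulr0 !addr0 subr_eq0 => /eqP.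
Qed.

Lemma lin_comb4 a b c l r (c' l' r' c2 l2 r2 c3 l3 r3 : S) :
  l = r -> l' = r' -> l2 = r2 -> l3 = r3 ->
  a - b = c * (l - r) + c' * (l' - r') + c2 * (l2 - r2) + c3 * (l3 - r3) ->
  a = b.
Proof.
by move=> -> -> -> -> /eqP; rewrite !subrr !mulr0 !addr0 subr_eq0 => /eqP.
Qed.

Section OneDerivation.
Variables (D : S -> S) (dD : derivation D).

Lemma derD x y : D (x + y) = D x + D y. Proof. exact: dD.1. Qed.
Lemma derM x y : D (x * y) = D x * y + x * D y. Proof. exact: dD.2. Qed.
Lemma der0 : D 0 = 0.
Proof. by apply: (addrI (D 0)); rewrite -derD !addr0. Qed.
Lemma derN x : D (- x) = - D x.
Proof. by apply: (addrI (D x)); rewrite -derD !subrr der0. Qed.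
Lemma derB x y : D (x - y) = D x - D y.
Proof. by rewrite derD derN. Qed.
Lemma der1 : D 1 = 0.
Proof.
by apply: (addrI (D 1)); rewrite addr0 -{3}(mulr1 1) derM mul1r mulr1.
Qed.
Lemma der_nat k : D k%:R = 0.
Proof.
elim: k => [|k IH]; first exact: der0.
by rewrite -addn1 natrD derD IH der1 addr0.
Qed.
Lemma der_natl k x : D (k%:R * x) = k%:R * D x.
Proof. by rewrite derM der_nat mul0r add0r. Qed.
Lemma der_sum I (r : seq I) (P : pred I) (E : I -> S) :
  D (\sum_(i <- r | P i) E i) = \sum_(i <- r | P i) D (E i).
Proof. exact: (big_morph D derD der0). Qed.

End OneDerivation.

Lemma derivation_comb n (c : 'I_n -> S) (d : 'I_n -> S -> S) :
  (forall i, derivation (d i)) -> derivation (fun x => \sum_i c i * d i x).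
Proof.
move=> dd; split=> x y.
  by rewrite -big_split; apply: eq_bigr => i _; rewrite (derD (dd i)) mulrDr.
rewrite mulr_suml mulr_sumr -big_split; apply: eq_bigr => i _ /=.
rewrite (derM (dd i)); ring.
Qed.

End Derivations.

Section InnerProduct.
Variables (S : comPzRingType) (n : nat) (sg : 'I_n -> S).
Implicit Types (u v w : 'rV[S]_n) (a : S).

(** The signs [sg] cover Euclidean and Minkowski space at once. *)
Definition dot v w : S := \sum_a sg a * (v 0 a * w 0 a).

Lemma dotC v w : dot v w = dot w v.
Proof. by apply: eq_bigr => a _; rewrite [v 0 a * _]mulrC. Qed.
Lemma dotDl u v w : dot (u + v) w = dot u w + dot v w.
Proof. by rewrite -big_split; apply: eq_bigr => a _ /=; rewrite !mxE; ring. Qed.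
Lemma dotZl a v w : dot (a *: v) w = a * dot v w.
Proof. by rewrite mulr_sumr; apply: eq_bigr => b _ /=; rewrite !mxE; ring. Qed.
Lemma dotDr u v w : dot w (u + v) = dot w u + dot w v.
Proof. by rewrite dotC dotDl !(dotC w). Qed.
Lemma dotZr a v w : dot w (a *: v) = a * dot w v.
Proof. by rewrite dotC dotZl dotC. Qed.
Lemma dotNl v w : dot (- v) w = - dot v w.
Proof. by rewrite -scaleN1r dotZl mulN1r. Qed.
Lemma dotNr v w : dot w (- v) = - dot w v.
Proof. by rewrite dotC dotNl dotC. Qed.
Lemma dot0l w : dot 0 w = 0.
Proof. by rewrite -(scale0r w) dotZl mul0r. Qed.

Definition dotE := (dotDl, dotDr, dotNl, dotNr, dotZl, dotZr).

(** A Gram matrix with invertible diagonal and zeros elsewhere makes the family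
    a basis: the matrix of the family is invertible, because over a commutative
    ring a one-sided inverse of a square matrix is two-sided. *)
Lemma orthogonal_complete (b : 'I_n -> 'rV[S]_n) v :
    (forall i j, i != j -> dot (b i) (b j) = 0) ->
    (forall i, invertible (dot (b i) (b i))) ->
    (forall i, dot v (b i) = 0) -> v = 0.
Proof.
move=> borth /fin_all_exists[t tP] v0.
pose B := \matrix_(i, k) b i 0 k.
pose C := \matrix_(k, j) (sg k * b j 0 k * t j).
have BC : B *m C = 1%:M.
  apply/matrixP => i j; rewrite !mxE.
  transitivity (dot (b i) (b j) * t j).
    by rewrite mulr_suml; apply: eq_bigr => k _; rewrite !mxE; ring.
  by have [->|ij] := eqVneq i j; rewrite ?tP // borth // mul0r.
have vC : v *m C = 0.
  apply/rowP => j; rewrite !mxE.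
  transitivity (dot v (b j) * t j).
    by rewrite mulr_suml; apply: eq_bigr => k _; rewrite !mxE; ring.
  by rewrite v0 mul0r.
by rewrite -[v]mulmx1 -(mulmx1C BC) mulmxA vC mul0mx.
Qed.

Section Derive.
Variables (D : S -> S) (dD : derivation D).

Local Notation dv := (map_mx D).

Lemma dvD v w : dv (v + w) = dv v + dv w.
Proof. by apply/rowP => k; rewrite !mxE (derD dD). Qed.
Lemma dvN v : dv (- v) = - dv v.
Proof. by apply/rowP => k; rewrite !mxE (derN dD). Qed.
Lemma dvZ a v : dv (a *: v) = D a *: v + a *: dv v.
Proof. by apply/rowP => k; rewrite !mxE (derM dD). Qed.
Lemma dv0 : dv 0 = 0 :> 'rV_n.
Proof. by apply/rowP => k; rewrite !mxE (der0 dD). Qed.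
Lemma der_dot v w : (forall k : 'I_n, D (sg k) = 0) ->
  D (dot v w) = dot (dv v) w + dot v (dv w).
Proof.
move=> sg0; rewrite (der_sum dD) -big_split; apply: eq_bigr => a _ /=.
by rewrite !(derM dD) sg0 !mxE; ring.
Qed.

End Derive.
End InnerProduct.

(** * The differential system along an adapted frame *)

(** The components of the second fundamental form along the frame [e1], [e2]
    are [2 H + W], [0] and [- W]; [al] and [be] are the values of the connection
    form; [nu] completes the frame and the normal space to the ambient space,
    with [eps nu = eps X] for the position vector [X]. *)
Section AdaptedFrame.
Variables (S : comPzRingType) (sg : 'I_5 -> S).
Variables (D1 D2 : S -> S) (dD1 : derivation D1) (dD2 : derivation D2).
Hypotheses (sg1 : forall a, D1 (sg a) = 0) (sg2 : forall a, D2 (sg a) = 0).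
Variables (eps kap al be s : S) (nu e1 e2 H W : 'rV[S]_5).

Local Notation "<< v , w >>" := (dot sg v w).
Local Notation dv1 := (map_mx D1).
Local Notation dv2 := (map_mx D2).

Hypotheses (eps1 : D1 eps = 0) (eps2 : D2 eps = 0) (epskap : eps * kap = eps).
Hypothesis comm : forall x,
  D1 (D2 x) - D2 (D1 x) = - (al * D1 x) - be * D2 x.
Hypotheses (nu1 : dv1 nu = kap *: e1) (nu2 : dv2 nu = kap *: e2).
Hypotheses (e11 : << e1, e1 >> = 1) (e22 : << e2, e2 >> = 1)
  (e12 : << e1, e2 >> = 0) (e1nu : << e1, nu >> = 0) (e2nu : << e2, nu >> = 0)
  (nunu : invertible << nu, nu >>).
Hypotheses (He1 : << H, e1 >> = 0) (He2 : << H, e2 >> = 0)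
  (Hnu : << H, nu >> = 0) (We1 : << W, e1 >> = 0) (We2 : << W, e2 >> = 0)
  (Wnu : << W, nu >> = 0) (HH : << H, H >> = s) (WH : << W, H >> = 0).
Hypotheses (D1e1 : dv1 e1 = al *: e2 + (2 *: H + W) - eps *: nu)
  (D1e2 : dv1 e2 = - (al *: e1))
  (D2e1 : dv2 e1 = be *: e2)
  (D2e2 : dv2 e2 = - (be *: e1) - W - eps *: nu).
Hypotheses (s2 : D2 s = 0) (sI : invertible s) (s1I : invertible (D1 s)).
Variable lam : S.
Hypothesis bitens : dv1 (dv1 H) + dv2 (dv2 H) - al *: dv2 H + be *: dv1 H
  + (2 * eps) *: H = lam *: nu.
Hypothesis anisotropic : forall v w,
  << v, nu >> = 0 -> invertible << v, w >> -> invertible << v, v >>.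
Hypothesis char0 : forall k : nat, invertible (k.+1%:R : S).

Let e1H : << e1, H >> = 0. Proof. by rewrite dotC. Qed.
Let e2H : << e2, H >> = 0. Proof. by rewrite dotC. Qed.
Let nuH : << nu, H >> = 0. Proof. by rewrite dotC. Qed.
Let e1W : << e1, W >> = 0. Proof. by rewrite dotC. Qed.
Let e2W : << e2, W >> = 0. Proof. by rewrite dotC. Qed.
Let nuW : << nu, W >> = 0. Proof. by rewrite dotC. Qed.
Let HW : << H, W >> = 0. Proof. by rewrite dotC. Qed.
Let e21 : << e2, e1 >> = 0. Proof. by rewrite dotC. Qed.
Let nue1 : << nu, e1 >> = 0. Proof. by rewrite dotC. Qed.
Let nue2 : << nu, e2 >> = 0. Proof. by rewrite dotC. Qed.
Let frameE := (e11, e22, e12, e1nu, e2nu, He1, He2, Hnu, We1, We2, Wnu, HH, WH,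
  (e1H, e2H, nuH, e1W, e2W, nuW, HW, e21, nue1, nue2)).

Let A := << W, W >>.

Let dot1 v w : D1 << v, w >> = << dv1 v, w >> + << v, dv1 w >>.
Proof. exact: der_dot. Qed.
Let dot2 v w : D2 << v, w >> = << dv2 v, w >> + << v, dv2 w >>.
Proof. exact: der_dot. Qed.

Let commv (v : 'rV[S]_5) :
  dv1 (dv2 v) - dv2 (dv1 v) = - (al *: dv1 v) - be *: dv2 v.
Proof. by apply/rowP => k; rewrite !mxE comm. Qed.

Let dvE := (dvD (n := 5) dD1, dvD (n := 5) dD2, dvN (n := 5) dD1,
  dvN (n := 5) dD2, dvZ (n := 5) dD1, dvZ (n := 5) dD2,
  der_nat dD1, der_nat dD2).

Let G := D1 be - D2 al + eps + al * al + be * be.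

(** The commutator of the two derivations applied to [e1] and, in [codazzi1], to
    [e2]. The tangential coefficient [G] is [eps] plus the curvature of the
    connection form; [gauss] identifies it. *)
Let codazzi2 : dv2 (2 *: H + W) = G *: e2 + (2 * al) *: (H + W).
Proof.
have := commv e1; rewrite D2e1 D1e1.
move defP: (2 *: H + W) => P.
rewrite !dvE D1e2 D2e2 nu2 eps2 -defP.
move=> /rowP E; apply/rowP => k; move: (E k); rewrite !mxE => {}E.
by apply: (lin_comb2 (c := -1) (c' := e2 0 k) E epskap); rewrite /G; ring.
Qed.

Let codazzi1 : dv1 W = - (G *: e1) - (2 * be) *: (H + W).
Proof.
have := commv e2; rewrite D2e2 D1e2 !dvE D1e1 D2e1 nu1 eps1.
move=> /rowP E; apply/rowP => k; move: (E k); rewrite !mxE => {}E.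
by apply: (lin_comb2 (c := -1) (c' := - e1 0 k) E epskap); rewrite /G; ring.
Qed.

Let gauss : G = A.
Proof.
have := dot2 (2 *: H + W) e2.
rewrite codazzi2 D2e2 !(dotE, frameE) -/A ?(mulr0, addr0, der0 dD2) => E.
by apply: (lin_comb1 (c := -1) E); ring.
Qed.

Let D1W : dv1 W = - (A *: e1) - (2 * be) *: (H + W).
Proof. by rewrite codazzi1 gauss. Qed.

Let dotsE := (dotE, D1e1, D1e2, D2e1, D2e2, D1W, nu1, nu2, frameE).

Let D1H_e1 : << dv1 H, e1 >> = - (2 * s).
Proof.
have := dot1 H e1; rewrite !dotsE ?(der0 dD1, der0 dD2) => E.
by apply: (lin_comb1 (c := -1) E); ring.
Qed.

Let D1H_e2 : << dv1 H, e2 >> = 0.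
Proof.
have := dot1 H e2; rewrite !dotsE ?(der0 dD1, der0 dD2) => E.
by apply: (lin_comb1 (c := -1) E); ring.
Qed.

Let D2H_e1 : << dv2 H, e1 >> = 0.
Proof.
have := dot2 H e1; rewrite !dotsE ?(der0 dD1, der0 dD2) => E.
by apply: (lin_comb1 (c := -1) E); ring.
Qed.

Let D2H_e2 : << dv2 H, e2 >> = 0.
Proof.
have := dot2 H e2; rewrite !dotsE ?(der0 dD1, der0 dD2) => E.
by apply: (lin_comb1 (c := -1) E); ring.
Qed.

Let D1H_H : 2 * << dv1 H, H >> = D1 s.
Proof. by rewrite -HH dot1 (dotC _ H); ring. Qed.

Let D2H_H : << dv2 H, H >> = 0.
Proof.
apply: (invertible_cancel0 (char0 1)).
by rewrite -s2 -HH dot2 (dotC _ H); ring.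
Qed.

Let D1H_W : << dv1 H, W >> = 2 * be * s.
Proof.
have := dot1 H W; rewrite !dotsE ?(der0 dD1, der0 dD2) => E.
by apply: (lin_comb1 (c := -1) E); ring.
Qed.

Let D2HW v : 2 * << dv2 H, v >> + << dv2 W, v >>
  = A * << e2, v >> + 2 * al * (<< H, v >> + << W, v >>).
Proof.
have := codazzi2; rewrite gauss !dvE => /(congr1 (fun u => << u, v >>)).
by rewrite !dotE => <-; ring.
Qed.

Let D2W_H : << dv2 W, H >> = 2 * al * s.
Proof.
have := D2HW H; rewrite D2H_H !frameE => E.
by apply: (lin_comb1 (c := 1) E); ring.
Qed.

Let D2H_W : << dv2 H, W >> = - (2 * al * s).
Proof.
have := dot2 H W; rewrite (dotC _ H (dv2 W)) D2W_H !frameE (der0 dD2) => E.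
by apply: (lin_comb1 (c := -1) E); ring.
Qed.

Let bitens_dot v : << nu, v >> = 0 ->
  << dv1 (dv1 H), v >> + << dv2 (dv2 H), v >> - al * << dv2 H, v >>
    + be * << dv1 H, v >> + 2 * eps * << H, v >> = 0.
Proof.
move=> nuv; have := congr1 (fun u => << u, v >>) bitens.
by rewrite !dotE nuv mulr0.
Qed.

Let D1D1_dot v : << dv1 (dv1 H), v >> = D1 << dv1 H, v >> - << dv1 H, dv1 v >>.
Proof. by rewrite dot1; ring. Qed.
Let D2D2_dot v : << dv2 (dv2 H), v >> = D2 << dv2 H, v >> - << dv2 H, dv2 v >>.
Proof. by rewrite dot2; ring. Qed.

Let D1H_nu : << dv1 H, nu >> = 0.
Proof.
have := dot1 H nu; rewrite !dotsE ?(der0 dD1, der0 dD2) => E.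
by apply: (lin_comb1 (c := -1) E); ring.
Qed.

Let D2H_nu : << dv2 H, nu >> = 0.
Proof.
have := dot2 H nu; rewrite !dotsE ?(der0 dD1, der0 dD2) => E.
by apply: (lin_comb1 (c := -1) E); ring.
Qed.

(** The tangent part of the biharmonic equation, here along [e1] and in [al0]
    along [e2]. *)
Let be_eq : 4 * be * s = - (3 * D1 s).
Proof.
have := bitens_dot nue1; rewrite D1D1_dot D2D2_dot !dotsE.
rewrite D1H_e1 D2H_e1 D2H_e2 D1H_e2 D1H_W D1H_nu.
rewrite (derN dD1) (der_natl dD1) ?(der0 dD1, der0 dD2) => E.
by apply: (lin_comb2 (c := -1) (c' := -1) E D1H_H); ring.
Qed.

Let al0 : al = 0.
Proof.
apply: (invertible_cancel0 sI); apply: (invertible_cancel0 (char0 3)).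
have := bitens_dot nue2; rewrite D1D1_dot D2D2_dot !dotsE.
rewrite D1H_e1 D2H_e1 D2H_e2 D1H_e2 D2H_W D2H_nu !(der0 dD1, der0 dD2) => E.
by apply: (lin_comb1 (c := -1) E); ring.
Qed.

(** [W] vanishes nowhere, because the derivative of [H] along [e1] has a nonzero
    component along it. *)
Let AI : invertible A.
Proof.
apply: (anisotropic (w := dv1 H)) => //; rewrite dotC D1H_W.
apply: (invertible_factor (x := 2)).
have -> : 2 * (2 * be * s) = - (3 * D1 s) by rewrite -be_eq; ring.
by apply/invertibleN/invertibleM.
Qed.

Let complete v : << v, e1 >> = 0 -> << v, e2 >> = 0 -> << v, H >> = 0 ->
  << v, W >> = 0 -> << v, nu >> = 0 -> v = 0.
Proof.
move=> v1 v2 vH vW vnu.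
have Finv1 : invertible (1 : S) by exists 1; rewrite mulr1.
pose b (i : 'I_5) := nth 0 [:: e1; e2; H; W; nu] i.
apply: (orthogonal_complete (sg := sg) (b := b)) => [i j|i|i]; rewrite /b.
- by case: i j => [[|[|[|[|[|?]]]]] ?] [[|[|[|[|[|?]]]]] ?] //= _; rewrite frameE.
- by case: i => [[|[|[|[|[|?]]]]] ?] //=; rewrite ?frameE.
- by case: i => [[|[|[|[|[|?]]]]] ?] //=.
Qed.

Section LogarithmicDerivative.

(* A quarter of the logarithmic derivative of [s], and the ratio [s / A]: with
   these the whole system has integer coefficients. *)
Variables (tau z : S).
Hypotheses (tauP : D1 s = 4 * tau * s) (zP : z * A = s).

Let tauI : invertible tau.
Proof.
apply: (invertible_factor (x := 4 * s)).
by have -> : 4 * s * tau = D1 s by rewrite tauP; ring.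
Qed.

Let beE : be = - (3 * tau).
Proof.
apply: (invertible_cancel (invertibleM (char0 3) sI)).
by apply: (lin_comb2 (c := 1) (c' := -3) be_eq tauP); ring.
Qed.

Let D1HE : dv1 H = - (2 * s) *: e1 + (2 * tau) *: H - (6 * tau * z) *: W.
Proof.
apply/subr0_eq; apply: complete; rewrite !dotsE.
- by rewrite D1H_e1; ring.
- by rewrite D1H_e2; ring.
- apply: (invertible_cancel0 (char0 1)).
  by apply: (lin_comb2 (c := 1) (c' := 1) D1H_H tauP); ring.
- rewrite -/A D1H_W beE.
  by apply: (lin_comb1 (c := 6 * tau) zP); ring.
- by rewrite D1H_nu; ring.
Qed.

Let D2HE : dv2 H = 0.
Proof.
apply: complete; rewrite ?D2H_e1 ?D2H_e2 ?D2H_H ?D2H_W ?D2H_nu // al0.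
by rewrite mulr0 mul0r oppr0.
Qed.

Let D1A : D1 A = 12 * tau * A.
Proof. by rewrite /A dot1 (dotC _ W) !dotsE -/A beE; ring. Qed.

Let bitens_W : 3 * D1 tau = 9 * tau * tau - A.
Proof.
apply: (invertible_cancel (invertibleM (char0 1) sI)).
have := bitens_dot nuW.
rewrite D1D1_dot D2HE (dv0 5 dD2) !dot0l D1H_W D1HE !dotsE beE -/A.
have -> : 2 * - (3 * tau) * s = - (6%:R * (tau * s)) by ring.
rewrite (derN dD1) (der_natl dD1) (derM dD1) tauP => E.
by apply: (lin_comb2 (c := -1) (c' := 36 * tau * tau) E zP); ring.
Qed.

(** The Gauss equation and the [W]-component of the biharmonic equation are two
    expressions of [D1 tau] that differ by a multiple of [eps]. *)
Let eps0 : eps = 0.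
Proof.
move: gauss; rewrite /G al0 (der0 dD2) beE (derN dD1) (der_natl dD1) => E.
by apply: (lin_comb2 (c := 1) (c' := 1) E bitens_W); ring.
Qed.

Let bitens_H : 6 * tau * tau * A - A * A - 6 * s * A - 54 * tau * tau * s = 0.
Proof.
apply: (invertible_cancel0 sI).
have := bitens_dot nuH.
have D1H_HE : << dv1 H, H >> = 2 * (tau * s).
  by rewrite D1HE !dotsE; ring.
rewrite D1D1_dot D2HE (dv0 5 dD2) !dot0l D1H_HE.
rewrite (der_natl dD1) (derM dD1) tauP D1HE !dotsE beE -/A eps0 => E.
apply: (invertible_cancel0 (char0 1)).
apply: (lin_comb3 (c := 3 * A) (c' := - (2 * s * A))
  (c'' := 108 * tau * tau * (z * A + s)) E bitens_W zP); ring.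
Qed.

(** The derivative of [bitens_H] along [e1], divided by [4 tau]. *)
Let bitens_H' :
  27 * tau * tau * A - 7 * A * A - 15 * s * A - 135 * tau * tau * s = 0.
Proof.
apply: (invertible_cancel0 (invertibleM (char0 3) tauI)).
have := congr1 D1 bitens_H.
have -> : 6 * tau * tau * A - A * A - 6 * s * A - 54 * tau * tau * s
  = 6 * (tau * (tau * A)) - A * A - 6 * (s * A) - 54 * (tau * (tau * s)).
  by ring.
rewrite !(derB dD1) !(der_natl dD1) !(derM dD1) D1A tauP (der0 dD1) => E.
apply: (lin_comb2 (c := 1) (c' := - (4 * tau * A - 36 * tau * s)) E bitens_W).
ring.
Qed.

(** Elimination of [tau * tau] between [bitens_H] and [bitens_H']. *)
Let A21 : A = 21 * s.
Proof.
apply: (invertible_cancel (invertibleM (invertibleM (char0 14) AI) AI)).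
apply: (lin_comb2 (c := 27 * (A - 5%:R * s)) (c' := - (6 * (A - 9 * s)))
  bitens_H bitens_H'); ring.
Qed.

(** The relation [A = 21 s] contradicts the different growth rates of [A] and
    [s] along [e1]; here [168 = 21 * (12 - 4)]. *)
Lemma absurd_tau : 1 = 0 :> S.
Proof.
have := congr1 D1 A21; rewrite D1A (der_natl dD1) tauP A21 => E.
apply: (invertible_cancel0 (invertibleM (char0 167) (invertibleM tauI sI))).
by apply: (lin_comb1 (c := 1) E); ring.
Qed.

End LogarithmicDerivative.

Lemma adapted_frame_absurd : 1 = 0 :> S.
Proof.
have [[t st] [q q4] [B AB]] := And3 sI (char0 3) AI.
apply: (@absurd_tau (D1 s * t * q) (s * B)).
  transitivity (D1 s * (s * t) * (4 * q)); last by ring.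
  by rewrite st q4 !mulr1.
by rewrite -mulrA (mulrC B) AB mulr1.
Qed.

End AdaptedFrame.

(** * Parametrized surfaces over a differential ring *)

Lemma sum_ord2 (V : nmodType) (E : 'I_2 -> V) : \sum_i E i = E 0 + E 1.
Proof.
by rewrite big_ord_recl big_ord1; congr (E _ + E _); apply: val_inj.
Qed.

(** The first vector is the normalized gradient of a function with differential
    [q], and the second spans the kernel of [q]. Here [delta] is the area density
    and [m / delta] the norm of [q]. *)
Lemma frame_along (S : comPzRingType) (g : 'I_2 -> 'I_2 -> S) (q : 'I_2 -> S)
    (delta m : S) :
    (forall i j, g i j = g j i) ->
    delta * delta = g 0 0 * g 1 1 - g 0 1 * g 0 1 ->
    m * m = g 0 0 * q 1 * q 1 - 2 * g 0 1 * q 0 * q 1 + g 1 1 * q 0 * q 0 ->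
    invertible delta -> invertible m ->
  exists c : 'I_2 -> 'I_2 -> S,
    [/\ forall a b, \sum_i \sum_j c a i * c b j * g i j = (a == b)%:R,
      \sum_i c 1 i * q i = 0 & invertible (\sum_i c 0 i * q i)].
Proof.
move=> gC delta2 m2 [t dt] [r mr].
pose y (i : 'I_2) : S := if i == 0 then g 1 1 * q 0 - g 0 1 * q 1
  else g 0 0 * q 1 - g 0 1 * q 0.
pose z (i : 'I_2) : S := if i == 0 then - q 1 else q 0.
exists (fun a i => if a == 0 then t * r * y i else r * z i).
have yq : y 0 * q 0 + y 1 * q 1 = m * m by rewrite m2 /y /=; ring.
split.
- move=> a b; rewrite !sum_ord2 (gC 1 0).
  have unit2 : (delta * t) * (delta * t) * ((m * r) * (m * r)) = 1.
    by rewrite dt mr !mulr1.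
  have unit1 : (m * r) * (m * r) = 1 by rewrite mr mulr1.
  case: a b => [[|[|//]] ?] [[|[|//]] ?] /=; rewrite /y /z /=; try by ring.
    transitivity ((delta * delta) * (m * m) * (t * t * r * r)).
      by rewrite delta2 m2; ring.
    by rewrite -[RHS]unit2; ring.
  transitivity ((m * m) * (r * r)); first by rewrite m2; ring.
  by rewrite -[RHS]unit1; ring.
- by rewrite sum_ord2 /z /=; ring.
- exists (delta * r); rewrite sum_ord2 /=.
  transitivity ((y 0 * q 0 + y 1 * q 1) * (r * r) * (delta * t)); first by ring.
  transitivity ((m * r) * (m * r)); last by rewrite mr mulr1.
  by rewrite yq dt; ring.
Qed.

(** The coordinate formulas for the connection, the second fundamental form, the
    tension and the bitension make sense over any ring with commuting
    derivations [d 0], [d 1]. The inverse metric is obtained from an orthonormal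
    frame [c], so that passing from coordinates to the frame is algebra. *)
Section CoordinateSurface.
Variables (S : comPzRingType) (sg : 'I_5 -> S).
Variables (d : 'I_2 -> S -> S).
Hypotheses (dd : forall i, derivation (d i))
  (dC : forall i j x, d i (d j x) = d j (d i x))
  (dsg : forall i a, d i (sg a) = 0).
Variables (eps kap half : S) (X nu : 'rV[S]_5).

Local Notation "<< v , w >>" := (dot sg v w).
Local Notation "\p_ i v" := (map_mx (d i) v)
  (at level 9, i at level 2, v at level 9, format "\p_ i  v").
Implicit Types (i j k l a b : 'I_2) (v w V : 'rV[S]_5) (x : S).

Definition vel i : 'rV[S]_5 := \p_i X.
Definition gram i j : S := << vel i, vel j >>.

Hypotheses (deps : forall i, d i eps = 0) (half2 : 2 * half = 1)
  (dnu : forall i, \p_i nu = kap *: vel i) (epsX : eps *: X = eps *: nu)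
  (velnu : forall i, << vel i, nu >> = 0)
  (epskap : eps * kap = eps) (epsnu : eps * << nu, nu >> = kap).

(* The components of the [a]-th frame vector are [c a 0] and [c a 1]. *)
Variable c : 'I_2 -> 'I_2 -> S.
Hypothesis c_orthonormal : forall a b,
  \sum_i \sum_j c a i * c b j * gram i j = (a == b)%:R.

Definition igram i j : S := \sum_a c a i * c a j.
Definition frame a : 'rV[S]_5 := \sum_i c a i *: vel i.
Definition Dframe a x : S := \sum_i c a i * d i x.
Local Notation D := Dframe.
Local Notation "\D_ a v" := (map_mx (Dframe a) v)
  (at level 9, a at level 2, v at level 9, format "\D_ a  v").

Definition tpart v : 'rV[S]_5 := \sum_a << v, frame a >> *: frame a.

(** The component along [nu] is removed only when [eps != 0]; when [eps = 0] the
    vectors to be projected have none. *)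
Definition npart v : 'rV[S]_5 := v - (eps * << v, nu >>) *: nu - tpart v.

Definition chris k i j : S :=
  half * \sum_l igram k l * (d i (gram j l) + d j (gram i l) - d l (gram i j)).
Definition cov i V : 'rV[S]_5 := \p_i V - (eps * << \p_i V, X >>) *: X.
Definition sff i j : 'rV[S]_5 :=
  cov i (vel j) - \sum_k chris k i j *: vel k.
Definition tens : 'rV[S]_5 := \sum_i \sum_j igram i j *: sff i j.
Definition nproj v : 'rV[S]_5 :=
  v - \sum_i \sum_j (igram i j * << v, vel i >>) *: vel j.
Definition rlap V : 'rV[S]_5 :=
  - \sum_i \sum_j igram i j *:
      (cov i (cov j V) - \sum_k chris k i j *: cov k V).
Definition bitens : 'rV[S]_5 :=
  - rlap tens - \sum_i \sum_j igram i j *: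
      (eps *: (<< tens, vel j >> *: vel i - << vel i, vel j >> *: tens)).

Let dD a : derivation (D a). Proof. exact: derivation_comb. Qed.

Let DE a x : D a x = c a 0 * d 0 x + c a 1 * d 1 x.
Proof. exact: sum_ord2. Qed.

Let DvE a v : \D_a v = c a 0 *: \p_0 v + c a 1 *: \p_1 v.
Proof. by apply/rowP => k; rewrite !mxE DE. Qed.

Let frameE a : frame a = c a 0 *: vel 0 + c a 1 *: vel 1.
Proof. exact: sum_ord2. Qed.

Let gramC i j : gram i j = gram j i. Proof. exact: dotC. Qed.

Let igramE i j : igram i j = c 0 i * c 0 j + c 1 i * c 1 j.
Proof. exact: sum_ord2. Qed.

Let igramC i j : igram i j = igram j i.
Proof. by rewrite !igramE; ring. Qed.

Let frame_orth a b : << frame a, frame b >> = (a == b)%:R.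
Proof.
by rewrite -c_orthonormal !sum_ord2 !frameE !dotE /gram; ring.
Qed.

Lemma gram_igram i j : \sum_k gram i k * igram k j = (i == j)%:R.
Proof.
pose C : 'M[S]_2 := \matrix_(a, i) c a i.
pose g : 'M[S]_2 := \matrix_(i, j) gram i j.
have CgC : C *m (g *m C^T) = 1%:M.
  apply/matrixP => a b; rewrite !mxE -c_orthonormal !sum_ord2 !mxE !sum_ord2.
  by rewrite !mxE; ring.
have /matrixP/(_ i j) := mulmx1C CgC; rewrite !mxE !sum_ord2 !mxE !sum_ord2.
by rewrite !mxE => <-; rewrite !igramE; ring.
Qed.

(** Coordinates of a tangent vector, recovered from its inner products with the
    frame. *)
Let frame_coord (x : 'I_2 -> S) i :
  x i = \sum_a << \sum_j x j *: vel j, frame a >> * c a i.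
Proof.
transitivity (\sum_k x k * (k == i)%:R).
  rewrite sum_ord2; case: i => [[|[|//]] ?]; rewrite /= ?mulr1 ?mulr0 ?addr0 ?add0r;
    by congr x; apply: val_inj.
under eq_bigr do rewrite -gram_igram.
by rewrite !sum_ord2 !frameE !igramE !dotE /gram; ring.
Qed.

Lemma tpartE v : tpart v = \sum_i \sum_j (igram i j * << v, vel i >>) *: vel j.
Proof.
rewrite /tpart !sum_ord2 !igramE !frameE !dotE.
by apply/rowP => k; rewrite !mxE; ring.
Qed.

Let tpartD v w : tpart (v + w) = tpart v + tpart w.
Proof. by rewrite -big_split; apply: eq_bigr => a _; rewrite dotE scalerDl. Qed.
Let tpartZ x v : tpart (x *: v) = x *: tpart v.
Proof. by rewrite scaler_sumr; apply: eq_bigr => a _; rewrite dotE scalerA. Qed.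
Let npartD v w : npart (v + w) = npart v + npart w.
Proof. by rewrite /npart tpartD; apply/rowP => k; rewrite !dotE !mxE; ring. Qed.
Let npartZ x v : npart (x *: v) = x *: npart v.
Proof. by rewrite /npart tpartZ; apply/rowP => k; rewrite !dotE !mxE; ring. Qed.
Let npartN v : npart (- v) = - npart v.
Proof. by rewrite -scaleN1r npartZ scaleN1r. Qed.

Let tpart_frame a v : << tpart v, frame a >> = << v, frame a >>.
Proof.
rewrite /tpart sum_ord2 !dotE !frame_orth.
case: a => [[|[|//]] ?] /=; rewrite mulr1 mulr0 ?addr0 ?add0r;
  by congr << _, frame _ >>; apply: val_inj.
Qed.

Let frame_nu a : << frame a, nu >> = 0.
Proof. by rewrite frameE !dotE !velnu !mulr0 addr0. Qed.
Let nu_frame a : << nu, frame a >> = 0.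
Proof. by rewrite dotC. Qed.

Let tpart_vel i : tpart (vel i) = vel i.
Proof.
rewrite tpartE exchange_big /=.
transitivity (\sum_j (i == j)%:R *: vel j).
  apply: eq_bigr => j _; rewrite -scaler_suml -gram_igram; congr (_ *: _).
  by apply: eq_bigr => k _; rewrite mulrC.
rewrite sum_ord2; case: i => [[|[|//]] ?]; rewrite /= ?scale1r ?scale0r ?addr0 ?add0r;
  by congr vel; apply: val_inj.
Qed.

Let npart_vel i : npart (vel i) = 0.
Proof. by rewrite /npart velnu tpart_vel mulr0 scale0r subr0 subrr. Qed.

Let npart_frame a : npart (frame a) = 0.
Proof. by rewrite frameE npartD !npartZ !npart_vel !scaler0 addr0. Qed.

Let npart_e v a : << npart v, frame a >> = 0.
Proof. by rewrite /npart !dotE tpart_frame nu_frame; ring. Qed.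

Let npart_vel0 v i : << npart v, vel i >> = 0.
Proof.
by rewrite -tpart_vel /tpart sum_ord2 dotDr !dotZr !npart_e; ring.
Qed.

(** Uses the symmetry of the second derivatives of the position vector. *)
Lemma koszul i j l : << \p_i (vel j), vel l >>
  = half * (d i (gram j l) + d j (gram i l) - d l (gram i j)).
Proof.
have dvC i' j' : \p_i' (vel j') = \p_j' (vel i').
  by apply/rowP => k; rewrite !mxE dC.
rewrite /gram !(der_dot (dd _)) // (dvC j i) (dvC l i) (dvC l j).
rewrite (dotC _ (vel i)) (dotC _ (vel j) (\p_ i _)).
set u := << \p_i (vel j), _ >>; transitivity (2 * half * u); last by ring.
by rewrite half2 mul1r.
Qed.

Let chrisE k i j : chris k i j = \sum_l igram k l * << \p_i (vel j), vel l >>.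
Proof.
by rewrite /chris mulr_sumr; apply: eq_bigr => l _; rewrite koszul; ring.
Qed.

Let chris_vec i j : \sum_k chris k i j *: vel k = tpart (\p_i (vel j)).
Proof.
rewrite tpartE exchange_big; apply: eq_bigr => k _ /=.
rewrite -scaler_suml chrisE; congr (_ *: _).
by apply: eq_bigr => l _; rewrite igramC.
Qed.

Let covE i V : cov i V = \p_i V - (eps * << \p_i V, nu >>) *: nu.
Proof.
rewrite /cov; congr (_ - _).
by rewrite -dotZr epsX dotZr mulrC -scalerA epsX scalerA mulrC.
Qed.

(** The Christoffel terms remove exactly the tangent part, so the second
    fundamental form is the normal part of the flat second derivative. *)
Lemma sffE i j : sff i j = npart (\p_i (vel j)).
Proof. by rewrite /sff chris_vec covE. Qed.

Definition sff_frame a b : 'rV[S]_5 := npart (\D_a (frame b)).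
Local Notation B := sff_frame.

Let dframe i b : \p_i (frame b) =
  (d i (c b 0) *: vel 0 + d i (c b 1) *: vel 1) +
  (c b 0 *: \p_i (vel 0) + c b 1 *: \p_i (vel 1)).
Proof.
rewrite frameE (dvD (dd i)) !(dvZ (dd i)).
by apply/rowP => k; rewrite !mxE; ring.
Qed.

Let npart_dframe i b : npart (\p_i (frame b)) =
  c b 0 *: sff i 0 + c b 1 *: sff i 1.
Proof.
rewrite dframe !npartD !npartZ !npart_vel !scaler0 !addr0 add0r.
by rewrite !sffE.
Qed.

Lemma sff_frameE a b :
  B a b = \sum_i \sum_j (c a i * c b j) *: sff i j.
Proof.
rewrite /B DvE npartD !npartZ !npart_dframe !sum_ord2.
move: (sff 0 0) (sff 0 1) (sff 1 0) (sff 1 1) => b00 b01 b10 b11.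
by apply/rowP => k; rewrite !mxE; ring.
Qed.

Lemma tensE : tens = B 0 0 + B 1 1.
Proof.
rewrite /tens !sff_frameE !sum_ord2 !igramE.
move: (sff 0 0) (sff 0 1) (sff 1 0) (sff 1 1) => b00 b01 b10 b11.
by apply/rowP => k; rewrite !mxE; ring.
Qed.

Let sffC i j : sff i j = sff j i.
Proof. by rewrite !sffE; congr npart; apply/rowP => k; rewrite !mxE dC. Qed.

Let BC a b : B a b = B b a.
Proof.
rewrite !sff_frameE !sum_ord2 (sffC 1 0).
move: (sff 0 0) (sff 0 1) (sff 1 1) => b00 b01 b11.
by apply/rowP => k; rewrite !mxE; ring.
Qed.

Let B_e a b b' : << B a b, frame b' >> = 0.
Proof. exact: npart_e. Qed.

Let D_nu a : \D_a nu = kap *: frame a.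
Proof.
rewrite DvE !dnu frameE.
by apply/rowP => k; rewrite !mxE; ring.
Qed.

Let D_sg a (m : 'I_5) : D a (sg m) = 0.
Proof. by rewrite DE !dsg !mulr0 addr0. Qed.

Let D_dot a v w : D a << v, w >> = << \D_a v, w >> + << v, \D_a w >>.
Proof. exact: der_dot. Qed.

Let D_nat a b b' : D a ((b == b')%:R) = 0.
Proof. exact: der_nat. Qed.

Let dframe_nu a b : << \D_a (frame b), nu >> = - (kap * (a == b)%:R).
Proof.
have := D_dot a (frame b) nu; rewrite frame_nu D_nu dotZr frame_orth (der0 (dD a)).
by move=> E; rewrite eq_sym; apply: (lin_comb1 (c := -1) E); ring.
Qed.

Let B_nu a b : << B a b, nu >> = 0.
Proof.
rewrite /B /npart !dotE dframe_nu /tpart sum_ord2 !dotE !frame_nu.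
by apply: (lin_comb2 (c := (a == b)%:R) (c' := (a == b)%:R * << nu, nu >>)
  epsnu epskap); ring.
Qed.

Let half_cancel x : 2 * x = 0 -> x = 0.
Proof. by apply: invertible_cancel0; exists half. Qed.

Let dframe_self a b : << \D_a (frame b), frame b >> = 0.
Proof.
apply: half_cancel; rewrite -(D_nat a b b) -frame_orth D_dot.
by rewrite (dotC _ (frame b)); ring.
Qed.

Let dframe_skew a : << \D_a (frame 1), frame 0 >> = - << \D_a (frame 0), frame 1 >>.
Proof.
have := D_dot a (frame 0) (frame 1); rewrite frame_orth (der0 (dD a)).
rewrite (dotC _ (frame 0)) => E.
by apply: (lin_comb1 (c := -1) E); ring.
Qed.

(* The connection form of the frame. *)
Definition conn a : S := << \D_a (frame 0), frame 1 >>.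

Let dframeE a b : \D_a (frame b) = B a b - (eps * (a == b)%:R) *: nu
  + tpart (\D_a (frame b)).
Proof.
rewrite /B /npart dframe_nu; apply/rowP => k; rewrite !mxE.
by apply: (lin_comb1 (c := - (a == b)%:R * nu 0 k) epskap); ring.
Qed.

Let dframe0 a : \D_a (frame 0) = B a 0 - (eps * (a == 0)%:R) *: nu
  + conn a *: frame 1.
Proof. by rewrite {1}dframeE /tpart sum_ord2 dframe_self scale0r add0r. Qed.

Let dframe1 a : \D_a (frame 1) = B a 1 - (eps * (a == 1)%:R) *: nu
  - conn a *: frame 0.
Proof.
by rewrite {1}dframeE /tpart sum_ord2 dframe_self dframe_skew scale0r addr0 scaleNr.
Qed.

(** The bracket of the two frame fields is tangent, hence determined by its
    inner products with the frame. *)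
Lemma frame_bracket x :
  D 0 (D 1 x) - D 1 (D 0 x) = - (conn 0 * D 0 x) - conn 1 * D 1 x.
Proof.
pose w i := D 0 (c 1 i) - D 1 (c 0 i).
have dcomm y : D 0 (D 1 y) - D 1 (D 0 y) = w 0 * d 0 y + w 1 * d 1 y.
  rewrite !DE !(derD (dd _)) !(derM (dd _)) /w !DE (dC 1 0).
  by ring.
have wvel : \sum_i w i *: vel i = \D_0 (frame 1) - \D_1 (frame 0).
  rewrite sum_ord2 !DvE !dframe; have -> : \p_1 (vel 0) = \p_0 (vel 1).
    by apply/rowP => k; rewrite !mxE dC.
  by rewrite /w !DE; apply/rowP => k; rewrite !mxE; ring.
have wE i : w i = - (conn 0 * c 0 i) - conn 1 * c 1 i.
  rewrite (frame_coord w) wvel sum_ord2 !dotE !dframe_self dframe_skew -/(conn 0).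
  by rewrite -/(conn 1); ring.
by rewrite dcomm !wE !DE; ring.
Qed.

(** The Ricci equation. In [nabla_i (nabla_j eta)] the only term that is not
    symmetric in [i] and [j] comes from the tangential part of the flat
    derivative [\p_j eta], whose components are given by the shape operator. *)
Lemma ricci (eta : 'rV[S]_5) :
    (forall i, << eta, vel i >> = 0) -> << eta, nu >> = 0 ->
    nproj (cov 0 (nproj (cov 1 eta))) = nproj (cov 1 (nproj (cov 0 eta))) ->
  \sum_b << eta, B 1 b >> *: B 0 b = \sum_b << eta, B 0 b >> *: B 1 b.
Proof.
move=> eta_vel eta_nu.
have nprojE i v : nproj (cov i v) = npart (\p_i v).
  rewrite /nproj -tpartE covE /npart; set t := (X in X *: nu).
  have -> : \p_i v - t *: nu = \p_i v + (- t) *: nu by rewrite scaleNr.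
  rewrite tpartD tpartZ [tpart nu]big1 ?scaler0 ?addr0 ?scaleNr //.
  by move=> a _; rewrite nu_frame scale0r.
have deta_nu i : << \p_i eta, nu >> = 0.
  have := der_dot (dd i) eta nu (dsg i); rewrite eta_nu dnu dotZr eta_vel.
  by rewrite (der0 (dd i)) mulr0 addr0.
have npart_deta i : npart (\p_i eta) = \p_i eta -
    (<< \p_i eta, frame 0 >> *: frame 0 + << \p_i eta, frame 1 >> *: frame 1).
  by rewrite /npart deta_nu mulr0 scale0r subr0 /tpart sum_ord2.
have npart2 i j : npart (\p_i (npart (\p_j eta))) = npart (\p_i (\p_j eta)) -
    (<< \p_j eta, frame 0 >> *: npart (\p_i (frame 0))
     + << \p_j eta, frame 1 >> *: npart (\p_i (frame 1))).
  rewrite npart_deta (dvD (dd i)) (dvN (dd i)) (dvD (dd i)) !(dvZ (dd i)).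
  rewrite !(npartD, npartN, npartZ) !npart_frame.
  by apply/rowP => k; rewrite !mxE; ring.
rewrite 2!(nprojE _ eta) !nprojE (npart2 0 1) (npart2 1 0).
have -> : \p_1 (\p_0 eta) = \p_0 (\p_1 eta).
  by apply/rowP => k; rewrite !mxE dC.
move=> E.
have eta_B a b : << eta, B a b >> = - << \D_a eta, frame b >>.
  have eta_e k : << eta, frame k >> = 0.
    by rewrite frameE dotDr !dotZr !eta_vel; ring.
  have := D_dot a eta (frame b); rewrite eta_e (der0 (dD a)) dframeE.
  rewrite /tpart sum_ord2 !(dotDr, dotNr, dotZr) !eta_e eta_nu => F.
  by apply: (lin_comb1 (c := -1) F); ring.
have BE a b : B a b
    = c a 0 *: npart (\p_0 (frame b)) + c a 1 *: npart (\p_1 (frame b)).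
  by rewrite /B DvE npartD !npartZ.
rewrite !sum_ord2 !eta_B !BE !DvE !dotE.
move: E; move: (npart _) (npart _) (npart _) (npart _) (npart _) => t0 t1 t2 t3 t4.
move=> /rowP E; apply/rowP => k; move: (E k); rewrite !mxE => {}E.
apply: (lin_comb1 (c := c 0 0 * c 1 1 - c 0 1 * c 1 0) E).
ring.
Qed.

Lemma tens_vel i : << tens, vel i >> = 0.
Proof. by rewrite tensE dotDl !npart_vel0 addr0. Qed.
Lemma tens_nu : << tens, nu >> = 0.
Proof. by rewrite tensE dotDl !B_nu addr0. Qed.

(** The rough Laplacian differs from the sum of the iterated derivatives along
    the frame by the derivative along [nabla_{e_0} e_0 + nabla_{e_1} e_1]. *)
Let frame_divergence k :
  \sum_i \sum_j igram i j * chris k i j + \sum_a D a (c a k)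
  = conn 0 * c 1 k - conn 1 * c 0 k.
Proof.
pose x k := \sum_i \sum_j igram i j * chris k i j + \sum_a D a (c a k).
have xE b : << \sum_l x l *: vel l, frame b >>
    = << \D_0 (frame 0), frame b >> + << \D_1 (frame 1), frame b >>.
  have chris_e i j : chris 0 i j * << vel 0, frame b >>
      + chris 1 i j * << vel 1, frame b >> = << \p_i (vel j), frame b >>.
    by rewrite -(tpart_frame b (\p_i (vel j))) -chris_vec sum_ord2 dotDl !dotZl.
  rewrite sum_ord2 dotDl !dotZl.
  transitivity (\sum_i \sum_j igram i j * (chris 0 i j * << vel 0, frame b >>
      + chris 1 i j * << vel 1, frame b >>) +
      \sum_a (D a (c a 0) * << vel 0, frame b >>
              + D a (c a 1) * << vel 1, frame b >>)).
    by rewrite /x !sum_ord2; ring.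
  rewrite !sum_ord2 !chris_e !DvE !dframe !(dotDl, dotZl) !igramE !DE.
  by ring.
rewrite -/(x k) (frame_coord x) sum_ord2 !xE !dframe_self dframe_skew.
by rewrite -/(conn 0) -/(conn 1); ring.
Qed.

Lemma bitens_frame : bitens = 0 -> exists lam,
  \D_0 (\D_0 tens) + \D_1 (\D_1 tens) - conn 0 *: \D_1 tens
    + conn 1 *: \D_0 tens + (2 * eps) *: tens = lam *: nu.
Proof.
move=> bitens0.
have dtens_nu i : << \p_i tens, nu >> = 0.
  have := der_dot (dd i) tens nu (dsg i); rewrite tens_nu dnu dotZr tens_vel.
  by rewrite (der0 (dd i)) mulr0 addr0.
have cov1 j : cov j tens = \p_j tens.
  by rewrite covE dtens_nu mulr0 scale0r subr0.
pose mu i j := eps * << \p_i (\p_j tens), nu >>.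
have cov2 i j : cov i (cov j tens) = \p_i (\p_j tens) - mu i j *: nu.
  by rewrite cov1 covE.
have trace_gram : \sum_i \sum_j igram i j * gram i j = 2.
  transitivity (\sum_i \sum_j gram i j * igram j i).
    by rewrite !sum_ord2 (igramC 1 0); ring.
  rewrite sum_ord2 !gram_igram.
  by rewrite -natrD.
exists (\sum_i \sum_j igram i j * mu i j).
move: bitens0; rewrite /bitens /rlap => E; move: E.
rewrite !sum_ord2 !cov2 !cov1 !tens_vel -!/(gram _ _).
move: (frame_divergence 0) (frame_divergence 1) trace_gram.
rewrite !sum_ord2 !DvE !(dvD (dd _)) !(dvZ (dd _)).
rewrite (_ : \p_1 (\p_0 tens) = \p_0 (\p_1 tens)); last first.
  by apply/rowP => k; rewrite !mxE dC.
rewrite !igramE !DE.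
clear cov2; move: mu (conn 0) (conn 1) => mu al be F0 F1 F2.
move: (\p_0 (\p_0 tens)) (\p_0 (\p_1 tens)) (\p_1 (\p_1 tens)) => t00 t01 t11.
move: (\p_0 tens) (\p_1 tens) => t0 t1; move: tens => t /rowP E.
apply/rowP => k; move: (E k).
rewrite !mxE => {}E.
apply: (lin_comb4 (c := 1) (c' := t0 0 k) (c2 := t1 0 k) (c3 := - eps * t 0 k)
  E F0 F1 F2).
by ring.
Qed.

Let H : 'rV[S]_5 := half *: tens.
Let s : S := << H, H >>.

(* The hypothesis is the eigenvector equation of [A_H] in coordinates; pairing
   it with the frame needs the metric to lower the index [k]. *)
Let shape_frame :
    (forall k, \sum_i \sum_j c 0 i * << sff i j, H >> * igram j k
      = 2 * s * c 0 k) ->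
  forall b, << B 0 b, H >> = 2 * s * (b == 0)%:R.
Proof.
move=> shape b.
have BE : << B 0 b, H >> = \sum_j (\sum_i c 0 i * << sff i j, H >>) * c b j.
  by rewrite sff_frameE !sum_ord2 !(dotDl, dotZl); ring.
have delta_c j : c b j = \sum_l (\sum_k gram l k * igram k j) * c b l.
  under eq_bigr do rewrite gram_igram.
  rewrite sum_ord2; case: j => [[|[|//]] ?]; rewrite /= ?mul1r ?mul0r ?addr0 ?add0r;
    by congr (c b); apply: val_inj.
rewrite BE.
have -> : \sum_j (\sum_i c 0 i * << sff i j, H >>) * c b j =
    \sum_k \sum_l (\sum_i \sum_j c 0 i * << sff i j, H >> * igram j k)
      * gram k l * c b l.
  under eq_bigr do rewrite delta_c.
  by rewrite !sum_ord2 (igramC 1 0) (gramC 1 0); ring.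
under eq_bigr do under eq_bigr do rewrite shape.
have := c_orthonormal 0 b; rewrite !sum_ord2 => E.
rewrite [b == 0]eq_sym; apply: (lin_comb1 (c := 2 * s) E); ring.
Qed.

(** The Ricci equation for [H] reduces to [2 s B(e_1, e_0) = 0], after which the
    frame is adapted in the sense of [adapted_frame_absurd]. *)
Lemma surface_absurd :
    (forall k : nat, invertible (k.+1%:R : S)) ->
    (forall v w, << v, nu >> = 0 -> invertible << v, w >> ->
       invertible << v, v >>) ->
    invertible << nu, nu >> ->
    invertible s -> invertible (D 0 s) -> D 1 s = 0 ->
    (forall k, \sum_i \sum_j c 0 i * << sff i j, H >> * igram j k
      = 2 * s * c 0 k) ->
    nproj (cov 0 (nproj (cov 1 H))) = nproj (cov 1 (nproj (cov 0 H))) ->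
    bitens = 0 ->
  1 = 0 :> S.
Proof.
move=> char0 aniso nunu sI D0sI D1s /shape_frame shape flat /bitens_frame[lam bit].
have B00H : << B 0 0, H >> = 2 * s by rewrite shape mulr1.
have B01H : << B 0 1, H >> = 0 by rewrite shape mulr0.
have H2 : 2 *: H = B 0 0 + B 1 1.
  by rewrite -tensE /H scalerA half2 scale1r.
have B11H : << B 1 1, H >> = 0.
  have := congr1 (fun v => << v, H >>) H2; rewrite dotZl dotDl B00H -/s => E.
  by apply: (lin_comb1 (c := -1) E); ring.
have H_e a : << H, frame a >> = 0.
  by rewrite /H dotZl tensE dotDl !B_e addr0 mulr0.
have H_nu : << H, nu >> = 0 by rewrite /H dotZl tens_nu mulr0.
have B10 : B 1 0 = 0.
  have Hvel i : << H, vel i >> = 0 by rewrite /H dotZl tens_vel mulr0.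
  have := ricci Hvel H_nu flat; rewrite !sum_ord2 (BC 1 0).
  rewrite !(dotC _ H) B11H B00H B01H !scale0r !addr0 => E.
  apply/rowP => k; move/rowP/(_ k): E; rewrite !mxE => E.
  by apply: (invertible_cancel0 (invertibleM (char0 1) sI)); rewrite -E.
have B01 : B 0 1 = 0 by rewrite BC.
have Dhalf a : D a half = 0.
  apply: (invertible_cancel0 (char0 1)).
  by rewrite -(der_natl (dD a)) half2 (der1 (dD a)).
have Deps a : D a eps = 0 by rewrite DE !deps !mulr0 addr0.
have D_H a : \D_a H = half *: \D_a tens.
  by rewrite /H (dvZ (dD a)) Dhalf scale0r add0r.
have W_e a : << - B 1 1, frame a >> = 0 by rewrite dotNl B_e oppr0.
have W_nu : << - B 1 1, nu >> = 0 by rewrite dotNl B_nu oppr0.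
have W_H : << - B 1 1, H >> = 0 by rewrite dotNl B11H oppr0.
have e00 : \D_0 (frame 0) = conn 0 *: frame 1 + (2 *: H - B 1 1) - eps *: nu.
  rewrite dframe0 H2 /= mulr1; move: (B 0 0) (B 1 1) (frame 1) => P Q f.
  by apply/rowP => k; rewrite !mxE; ring.
have e01 : \D_0 (frame 1) = - (conn 0 *: frame 0).
  by rewrite dframe1 B01 /= mulr0 scale0r subr0 sub0r.
have e10 : \D_1 (frame 0) = conn 1 *: frame 1.
  by rewrite dframe0 B10 /= mulr0 scale0r subr0 add0r.
have e11 : \D_1 (frame 1) = - (conn 1 *: frame 0) - - B 1 1 - eps *: nu.
  rewrite dframe1 /= mulr1; move: (B 1 1) (frame 0) => Q f.
  by apply/rowP => k; rewrite !mxE; ring.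
have bitH : \D_0 (\D_0 H) + \D_1 (\D_1 H) - conn 0 *: \D_1 H + conn 1 *: \D_0 H
    + (2 * eps) *: H = (half * lam) *: nu.
  rewrite !D_H !(dvZ (dD _)) !Dhalf !scale0r !add0r /H.
  rewrite -(scalerA half lam) -bit.
  move: (\D_0 (\D_0 tens)) (\D_1 (\D_1 tens)) => t00 t11.
  move: (\D_0 tens) (\D_1 tens) => t0 t1; move: tens => t.
  by apply/rowP => k; rewrite !mxE; ring.
exact: (@adapted_frame_absurd S sg (D 0) (D 1) (dD 0) (dD 1) (D_sg 0) (D_sg 1)
  eps kap (conn 0) (conn 1) s nu (frame 0) (frame 1) H (- B 1 1)
  (Deps 0) (Deps 1) epskap frame_bracket (D_nu 0) (D_nu 1)
  (frame_orth 0 0) (frame_orth 1 1) (frame_orth 0 1) (frame_nu 0) (frame_nu 1)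
  nunu (H_e 0) (H_e 1) H_nu (W_e 0) (W_e 1) W_nu erefl W_H e00 e01 e10 e11
  D1s sI D0sI (half * lam) bitH aniso char0).
Qed.

End CoordinateSurface.

(** * Smooth functions on an open set *)
Lemma near_eq_differentiable (K : numFieldType) (V W : normedModType K)
  (f g : V -> W) x :
  (\near x, f x = g x) -> differentiable f x -> differentiable g x.
Proof.
move=> fg df; have [dc /eqaddoP dE] := (diff_locallyP _ _).1 df.
have fgx : f x = g x by apply: nbhs_singleton fg.
have gE : g \o shift x = cst (g x) + 'd f x +o_ 0 id.
  apply/eqaddoP => e e0; near=> h.
  have -> : (g \o shift x - (cst (g x) + 'd f x)) h
    = (f \o shift x - (cst (f x) + 'd f x)) h.
    rewrite /= -fgx; congr (_ - _); apply/esym; near: h.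
    by have := fg; rewrite (near_shift 0 x) subr0; apply.
  by near: h; apply: dE.
have dgE := diff_unique dc gE.
by apply/diff_locallyP; rewrite dgE.
Unshelve. all: by end_near. Qed.

Section SmoothClosure.
Context {R : realType} {n : nat}.
Variables (U : set 'rV[R]_n.+1) (oU : open U).

Let nearU u : U u -> \forall x \near u, U x.
Proof. by move=> Uu; apply: open_nbhs_nbhs. Qed.

Lemma partial_local (V : normedModType R) i (h k : 'rV[R]_n.+1 -> V) u :
  U u -> (forall x, U x -> h x = k x) -> partial i h u = partial i k u.
Proof.
move=> Uu hk; apply: near_eq_derive.
by near=> x; apply: hk; near: x; apply: nearU.
Unshelve. all: by end_near. Qed.

Lemma differentiable_local (V : normedModType R) (h k : 'rV[R]_n.+1 -> V) u :
  U u -> (forall x, U x -> h x = k x) -> differentiable h u -> differentiable k u.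
Proof.
move=> Uu hk dh.
apply: (near_eq_differentiable _ dh).
by near=> x; apply: hk; near: x; apply: nearU.
Unshelve. all: by end_near. Qed.

Lemma smooth_on_partial (V : normedModType R) i (h : 'rV[R]_n.+1 -> V) :
  smooth_on U h -> smooth_on U (partial i h).
Proof.
by move=> sh s u Uu; have := sh (rcons s i) u Uu; rewrite foldr_rcons.
Qed.

(** Smoothness is coinductive: a class of differentiable functions that is stable
    under partial derivatives, up to equality on [U], consists of smooth
    functions. *)
Lemma smooth_on_coind (V : normedModType R) (P : ('rV[R]_n.+1 -> V) -> Prop) h :
    (forall k, P k -> forall u, U u -> differentiable k u) ->
    (forall k i, P k ->
       exists2 k', P k' & forall u, U u -> partial i k u = k' u) ->
  P h -> smooth_on U h.
Proof.
move=> Pd Pp Ph s.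
suff [k Pk hk] : exists2 k, P k & forall u, U u -> foldr partial h s u = k u.
  move=> u Uu; apply: (differentiable_local Uu (h := k)); last exact: Pd.
  by move=> x Ux; rewrite hk.
elim: s => [|i s [k Pk hk]] /=; first by exists h.
have [k' Pk' kk'] := Pp k i Pk; exists k' => // u Uu.
by rewrite -kk' //; apply: partial_local.
Qed.

Lemma smooth_on_local (V : normedModType R) (h k : 'rV[R]_n.+1 -> V) :
  (forall x, U x -> h x = k x) -> smooth_on U h -> smooth_on U k.
Proof.
move=> hk sh.
apply: (@smooth_on_coind V
  (fun k => exists2 h, smooth_on U h & forall x, U x -> h x = k x)).
- move=> k' [h' sh' hk'] u Uu.
  by apply: (differentiable_local Uu hk'); apply: (sh' [::]).
- move=> k' i [h' sh' hk']; exists (partial i h') => [|u Uu].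
    by exists (partial i h') => //; apply: smooth_on_partial.
  by apply: partial_local => // x Ux; rewrite hk'.
- by exists h.
Qed.

(** Proving that one inverse or square root is smooth would need formulas for its
    iterated derivatives. The whole closure is instead stable under partial
    derivatives at once, since these are again sums, products, inverses and
    square roots, and [smooth_on_coind] applies. *)
Inductive smooth_closure : ('rV[R]_n.+1 -> R^o) -> Prop :=
| closure_base h : smooth_on U h -> smooth_closure h
| closure_add h k : smooth_closure h -> smooth_closure k ->
    smooth_closure (fun u => h u + k u)
| closure_mul h k : smooth_closure h -> smooth_closure k ->
    smooth_closure (fun u => h u * k u)
| closure_inv h : smooth_closure h -> (forall u, U u -> h u != 0) ->
    smooth_closure (fun u => (h u)^-1)
| closure_sqrt h : smooth_closure h -> (forall u, U u -> 0 < h u) ->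
    smooth_closure (fun u => Num.sqrt (h u)).

Lemma smooth_on_cst (V : normedModType R) (a : V) :
  smooth_on U (fun=> a : V).
Proof.
apply: (@smooth_on_coind V (fun k => exists b, k = (fun=> b))).
- by move=> k [b ->] u _; exact: differentiable_cst.
- move=> k i [b ->]; exists (fun=> 0) => [|u Uu]; first by exists 0.
  exact: derive_cst.
- by exists a.
Qed.

Lemma differentiable_sqrt (x : R) : 0 < x ->
  differentiable (Num.sqrt : R^o -> R^o) x.
Proof.
by move=> x0; apply/derivable1_diffP; have [] := is_derive1_sqrt x0.
Qed.

Lemma smooth_closure_differentiable h u :
  smooth_closure h -> U u -> differentiable h u.
Proof.
move=> ch Uu; elim: h / ch => [h sh|h k _ dh _ dk|h k _ dh _ dk|h _ dh h0|h _ dh h0].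
- exact: (sh [::]).
- exact: differentiableD.
- exact: differentiableM.
- by apply: differentiableV => //; apply: h0.
- by apply: (differentiable_comp dh); apply: differentiable_sqrt; apply: h0.
Qed.

Lemma smooth_closure_partial i h : smooth_closure h ->
  exists2 k, smooth_closure k & forall u, U u -> partial i h u = k u.
Proof.
move=> ch; elim: h / ch =>
  [h sh|h k ch [h' ch' hE] ck [k' ck' kE]|h k ch [h' ch' hE] ck [k' ck' kE]
  |h ch [h' ch' hE] h0|h ch [h' ch' hE] h0].
- by exists (partial i h) => //; apply/closure_base/smooth_on_partial.
- exists (fun u => h' u + k' u) => [|u Uu]; first exact: closure_add.
  rewrite -hE // -kE // /partial deriveD //;
    by apply: diff_derivable; apply: smooth_closure_differentiable.
- exists (fun u => h u * k' u + k u * h' u) => [|u Uu].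
    by apply: closure_add; apply: closure_mul.
  rewrite -hE // -kE // /partial deriveM //;
    by apply: diff_derivable; apply: smooth_closure_differentiable.
- exists (fun u => -1 * ((h u)^-1 * (h u)^-1) * h' u) => [|u Uu].
    have c1 := closure_base (smooth_on_cst (-1 : R^o)).
    by have ci := closure_inv ch h0; do 3?[apply: closure_mul => //].
  rewrite -hE // /partial deriveV //; last 2 first.
    exact: h0.
    by apply: diff_derivable; apply: smooth_closure_differentiable.
  by rewrite /GRing.scale /= -exprVn expr2 mulN1r.
- have c2 := closure_base (smooth_on_cst (2 : R^o)).
  have cs := closure_sqrt ch h0.
  exists (fun u => (2 * Num.sqrt (h u))^-1 * h' u) => [|u Uu].
    apply: closure_mul => //; apply: closure_inv; first exact: closure_mul.
    by move=> u Uu; rewrite mulf_neq0 ?pnatr_eq0 // gt_eqF // sqrtr_gt0 h0.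
  have dh := smooth_closure_differentiable ch Uu.
  have ds := differentiable_sqrt (h0 u Uu).
  rewrite -hE // /partial !deriveE //; last exact: differentiable_comp.
  rewrite diff_comp //= diff1E // derive1E.
by have [_ ->] := is_derive1_sqrt (h0 u Uu); rewrite /GRing.scale /= mulrC.
Qed.

Lemma smooth_closure_smooth h : smooth_closure h -> smooth_on U h.
Proof.
apply: smooth_on_coind => [k ck u|k i ck].
  exact: smooth_closure_differentiable.
exact: smooth_closure_partial.
Qed.

End SmoothClosure.

(** * Symmetry of second derivatives *)

Section Clairaut.
Context {R : realType} {n : nat}.
Implicit Types (h : 'rV[R]_n.+1 -> R^o) (u v w p q : 'rV[R]_n.+1).

Lemma derive_shift_point h v p q :
  'D_v (fun z => h (z + q) : R^o) p = 'D_v h (p + q).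
Proof.
rewrite /derive; set f1 := fun t => t^-1 *: _; set f2 := fun t => t^-1 *: _.
by suff -> : f1 = f2 by []; apply/funext => t; rewrite /f1 /f2 /= addrA.
Qed.

Lemma differentiable_shift_point h p q :
  differentiable h (p + q) -> differentiable (fun z => h (z + q) : R^o) p.
Proof.
by move=> dh; apply: (@differentiable_comp _ _ _ _ (fun z => z + q) h).
Qed.

Lemma line_mean_value h v p (t : R) : 0 < t ->
    (forall x, 0 <= x <= t -> differentiable h (x *: v + p)) ->
  exists2 c, 0 < c < t & h (t *: v + p) - h p = 'D_v h (c *: v + p) * t.
Proof.
move=> t0 dh; pose l (x : R) : R^o := h (x *: v + p).
have dl (x : R) : 0 <= x <= t ->
    is_derive (x : R^o) (1 : R^o) l ('D_v h (x *: v + p)).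
  move=> xt; have dlx : differentiable l x.
    apply: (@differentiable_comp _ _ _ _ (fun x : R^o => x *: v + p) h).
      apply: differentiableD; last exact: differentiable_cst.
      by apply: differentiableZl; apply: ex_diff.
    exact: dh.
  apply: DeriveDef; first exact: diff_derivable.
  rewrite /derive; set f1 := fun t => t^-1 *: _; set f2 := fun t => t^-1 *: _.
  suff -> : f1 = f2 by []; apply/funext => y.
  by rewrite /f1 /f2 /l /= [y%:A]mulr1 scalerDl addrA.
have [||c] := @MVT R l (fun x => 'D_v h (x *: v + p)) 0 t t0.
- by move=> x; rewrite in_itv /= => /andP[/ltW ? /ltW ?]; apply: dl; apply/andP.
- apply/continuous_in_subspaceT => x; rewrite inE /= in_itv /= => xt.
  by apply/differentiable_continuous/derivable1_diffP; have [] := dl x xt.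
- rewrite in_itv /= => ct; rewrite /l scale0r add0r subr0 => E.
  by exists c.
Qed.

(** The second difference of [h] over a parallelogram is a second derivative at an
    inner point. It is symmetric in [v] and [w], whence [clairaut]. *)
Lemma square_mean_value h v w u (t : R) : 0 < t ->
    (forall x y, 0 <= x <= t -> 0 <= y <= t ->
      differentiable h (x *: v + (y *: w + u)) /\
      differentiable ('D_v h) (x *: v + (y *: w + u))) ->
  exists x y, [/\ 0 < x < t, 0 < y < t &
    h (t *: v + (t *: w + u)) - h (t *: v + u) - h (t *: w + u) + h u
    = 'D_w ('D_v h) (x *: v + (y *: w + u)) * t * t].
Proof.
move=> t0 dh.
have t1 : 0 <= t <= t by rewrite lexx ltW.
have t2 : 0 <= (0 : R) <= t by rewrite lexx ltW.
pose g z : R^o := h (z + t *: w) - h z.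
have addtw x : x *: v + u + t *: w = x *: v + (t *: w + u).
  by rewrite -addrA (addrC u).
have dg0 x : 0 <= x <= t ->
    differentiable (fun z => h (z + t *: w) : R^o) (x *: v + u).
  move=> xt; apply: differentiable_shift_point.
  by rewrite addtw; apply: (dh x t xt t1).1.
have dg1 x : 0 <= x <= t -> differentiable h (x *: v + u).
  by move=> xt; have := (dh x 0 xt t2).1; rewrite scale0r add0r.
have [|x xt gE] := @line_mean_value g v u t t0.
  by move=> x xt; apply: differentiableB; [apply: dg0|apply: dg1].
have xt' : 0 <= x <= t by case/andP: xt => /ltW -> /ltW ->.
have [|y yt kE] := @line_mean_value ('D_v h) w (x *: v + u) t t0.
  move=> y yt; have := (dh x y xt' yt).2.
  by rewrite addrCA.
exists x, y; split => //.
move: gE; rewrite /g deriveB; last 2 first.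
  exact/diff_derivable/dg0.
  exact/diff_derivable/dg1.
rewrite derive_shift_point addtw addtw.
have -> : x *: v + (t *: w + u) = t *: w + (x *: v + u) by rewrite addrCA.
rewrite kE.
have -> : x *: v + (y *: w + u) = y *: w + (x *: v + u) by rewrite addrCA.
move=> <-; rewrite (addrC u (t *: w)); rewrite opprB !addrA. 
by ring.
Qed.

Let dist_half_absurd (a b c : R) :
  `|a - c| < `|a - b| / 2 -> `|b - c| < `|a - b| / 2 -> False.
Proof.
move=> ac bc; have := le_lt_trans (ler_distD c a b) (ltrD ac _).
rewrite (distrC c) => /(_ _ bc); rewrite -splitr ltxx; exact: notF.
Qed.

Lemma clairaut h v w u :
    (\forall x \near u, [/\ differentiable h x, differentiable ('D_v h) x &
       differentiable ('D_w h) x]) ->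
    {for u, continuous ('D_w ('D_v h) : _ -> R^o)} ->
    {for u, continuous ('D_v ('D_w h) : _ -> R^o)} ->
  'D_w ('D_v h) u = 'D_v ('D_w h) u.
Proof.
move=> dh cvw cwv; apply/eqP/negPn/negP => neq.
pose e := `|'D_w ('D_v h) u - 'D_v ('D_w h) u| / 2.
have e0 : 0 < e by rewrite divr_gt0 // normr_gt0 subr_eq0.
have near_vw : \forall x \near u, `|'D_w ('D_v h) u - 'D_w ('D_v h) x| < e.
  by move/cvgrPdist_lt: cvw; apply.
have near_wv : \forall x \near u, `|'D_v ('D_w h) u - 'D_v ('D_w h) x| < e.
  by move/cvgrPdist_lt: cwv; apply.
have near_all := filterI (filterI near_vw near_wv) dh.
have [r /= r0 rP] := (nbhs_ballP _ _).1 (near_all _ _).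
pose N := `|v| + `|w| + 1.
have N0 : 0 < N by rewrite ltr_wpDl // addr_ge0.
pose t := r / (2 * N).
have t0 : 0 < t by rewrite divr_gt0 // mulr_gt0.
have in_ball x y : 0 <= x <= t -> 0 <= y <= t -> ball u r (x *: v + (y *: w + u)).
  move=> /andP[x0 xt] /andP[y0 yt]; rewrite -ball_normE /ball_ /=.
  rewrite addrA opprD addrCA subrr addr0 normrN.
  rewrite (le_lt_trans (ler_normD _ _)) // !normrZ !ger0_norm //.
  apply: (@le_lt_trans _ _ (t * N)).
    rewrite /N !mulrDr mulr1 -[X in X <= _]addr0.
    by rewrite !lerD // ?ler_wpM2r // ltW.
  by rewrite /t invfM mulrA mulfVK ?gt_eqF // ltr_pdivrMr // ltr_pMr // ltr1n.
have [|x [y [xt yt E1]]] := @square_mean_value h v w u t t0.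
  by move=> x y xt yt; have [_ [? ? ?]] := rP _ (in_ball x y xt yt).
have [|x' [y' [xt' yt' E2]]] := @square_mean_value h w v u t t0.
  move=> x' y' xt' yt'; have := in_ball y' x' yt' xt'.
  by rewrite addrCA => /rP[_ []].
have wk (z : R) : 0 < z < t -> 0 <= z <= t by case/andP=> /ltW -> /ltW ->.
have [[B1 _] _] := rP _ (in_ball x y (wk _ xt) (wk _ yt)).
have := in_ball y' x' (wk _ yt') (wk _ xt'); rewrite addrCA => /rP[[_ B2] _].
have EE : 'D_w ('D_v h) (x *: v + (y *: w + u))
    = 'D_v ('D_w h) (x' *: w + (y' *: v + u)).
  apply: (mulIf (lt0r_neq0 t0)); apply: (mulIf (lt0r_neq0 t0)).
  apply: (etrans (esym E1)); apply: etrans E2; rewrite (addrCA (t *: w)).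
  by congr (_ + _); rewrite addrAC.
move: B1 B2; rewrite EE => B1 B2.
by have := dist_half_absurd B1 B2.
Qed.

End Clairaut.

(** * The differential ring of smooth functions *)
Section SmoothRing.
Context {R : realType} {n : nat} {U : set 'rV[R]_n.+1}.

(** Functions are normalized to [0] outside [U], so that equality of elements is
    equality on [U]. *)
Record smooth_fun (oU : open U) := SmoothFun {
  smooth_val :> 'rV[R]_n.+1 -> R^o;
  smooth_valP : smooth_on U smooth_val;
  smooth_val0 : forall u, ~ U u -> smooth_val u = 0 }.

Variable oU : open U.
Local Notation S := (smooth_fun oU).
Implicit Types (f g : S) (h : 'rV[R]_n.+1 -> R^o) (u : 'rV[R]_n.+1).

Lemma smooth_ext f g : (forall u, U u -> f u = g u) -> f = g.
Proof.
case: f g => [f sf f0] [g sg g0] /= fg.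
have E : f = g.
  apply/funext => u; have [/fg //|Uu] := pselect (U u).
  by rewrite f0 ?g0.
rewrite E in sf f0 *.
by congr SmoothFun; apply: Prop_irrelevance.
Qed.

Lemma extend0_subproof h : smooth_on U h ->
  smooth_on U (fun u => if `[< U u >] then h u else 0).
Proof. by apply: smooth_on_local => // x Ux; rewrite asboolT. Qed.

Lemma extend0_subproof0 h u : ~ U u -> (if `[< U u >] then h u else 0) = 0.
Proof. by move=> Uu; rewrite asboolF. Qed.

(* The ring operations are projections of opaque existence proofs: they are
   characterized by their values on [U], and never unfold. *)
Fact extend_sig h : smooth_on U h -> {f : S | forall u, U u -> f u = h u}.
Proof.
move=> sh; exists (SmoothFun oU (extend0_subproof sh) (@extend0_subproof0 h)).
by move=> u Uu /=; rewrite asboolT.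
Qed.

Definition mk_smooth h (sh : smooth_on U h) : S := sval (extend_sig sh).

Lemma mk_smoothE h (sh : smooth_on U h) u : U u -> mk_smooth sh u = h u.
Proof. exact: (svalP (extend_sig sh)). Qed.

Let base f : smooth_closure U f.
Proof. by apply: closure_base; apply: smooth_valP. Qed.

Fact cst_sig (a : R) : {k : S | forall u, U u -> k u = a}.
Proof. exact: extend_sig (smooth_on_cst oU (a : R^o)). Qed.
Fact add_sig f g : {k : S | forall u, U u -> k u = f u + g u}.
Proof.
exact: extend_sig (smooth_closure_smooth oU (closure_add (base f) (base g))).
Qed.
Fact mul_sig f g : {k : S | forall u, U u -> k u = f u * g u}.
Proof.
exact: extend_sig (smooth_closure_smooth oU (closure_mul (base f) (base g))).
Qed.
Fact opp_sig f : {k : S | forall u, U u -> k u = - f u}.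
Proof.
have [m mE] := cst_sig (-1); have [k kE] := mul_sig m f.
by exists k => u Uu; rewrite kE // mE // mulN1r.
Qed.
Fact d_sig i f : {k : S | forall u, U u -> k u = partial i f u}.
Proof. exact: extend_sig (smooth_on_partial i (smooth_valP f)). Qed.

Definition smooth_cst (a : R) : S := sval (cst_sig a).
Definition smooth_add f g : S := sval (add_sig f g).
Definition smooth_mul f g : S := sval (mul_sig f g).
Definition smooth_opp f : S := sval (opp_sig f).
Definition smooth_d i f : S := sval (d_sig i f).

Let smoothE u (Uu : U u) :=
  (fun f g => svalP (add_sig f g) u Uu : smooth_add f g u = f u + g u,
   fun f g => svalP (mul_sig f g) u Uu : smooth_mul f g u = f u * g u,
   fun f => svalP (opp_sig f) u Uu : smooth_opp f u = - f u,
   fun a => svalP (cst_sig a) u Uu : smooth_cst a u = a).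

HB.instance Definition _ := gen_eqMixin (smooth_fun oU).
HB.instance Definition _ := gen_choiceMixin (smooth_fun oU).

Fact smooth_addA : associative smooth_add.
Proof. by move=> f g k; apply: smooth_ext => u Uu; rewrite !(smoothE Uu) addrA. Qed.
Fact smooth_addC : commutative smooth_add.
Proof. by move=> f g; apply: smooth_ext => u Uu; rewrite !(smoothE Uu) addrC. Qed.
Fact smooth_add0 : left_id (smooth_cst 0) smooth_add.
Proof. by move=> f; apply: smooth_ext => u Uu; rewrite !(smoothE Uu) add0r. Qed.
Fact smooth_addN : left_inverse (smooth_cst 0) smooth_opp smooth_add.
Proof.
by move=> f; apply: smooth_ext => u Uu; rewrite !(smoothE Uu) addNr.
Qed.
HB.instance Definition _ := GRing.isZmodule.Build (smooth_fun oU)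
  smooth_addA smooth_addC smooth_add0 smooth_addN.

Fact smooth_mulA : associative smooth_mul.
Proof. by move=> f g k; apply: smooth_ext => u Uu; rewrite !(smoothE Uu) mulrA. Qed.
Fact smooth_mulC : commutative smooth_mul.
Proof. by move=> f g; apply: smooth_ext => u Uu; rewrite !(smoothE Uu) mulrC. Qed.
Fact smooth_mul1 : left_id (smooth_cst 1) smooth_mul.
Proof. by move=> f; apply: smooth_ext => u Uu; rewrite !(smoothE Uu) mul1r. Qed.
Fact smooth_mulDl : left_distributive smooth_mul +%R.
Proof. by move=> f g k; apply: smooth_ext => u Uu; rewrite !(smoothE Uu) mulrDl. Qed.
HB.instance Definition _ := GRing.Zmodule_isComPzRing.Build (smooth_fun oU)
  smooth_mulA smooth_mulC smooth_mul1 smooth_mulDl.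

Section Eval.
Variables (u : 'rV[R]_n.+1) (Uu : U u).

Lemma smooth_evD f g : (f + g) u = f u + g u.
Proof. by rewrite !(smoothE Uu). Qed.
Lemma smooth_evM f g : (f * g) u = f u * g u.
Proof. by rewrite !(smoothE Uu). Qed.
Lemma smooth_evN f : (- f) u = - f u.
Proof. by rewrite !(smoothE Uu). Qed.
Lemma smooth_evC a : smooth_cst a u = a.
Proof. by rewrite !(smoothE Uu). Qed.
Lemma smooth_ev0 : (0 : S) u = 0.
Proof. exact: smooth_evC. Qed.
Lemma smooth_ev1 : (1 : S) u = 1.
Proof. exact: smooth_evC. Qed.
Lemma smooth_evn k : (k%:R : S) u = k%:R.
Proof.
elim: k => [|k IH]; first exact: smooth_ev0.
by rewrite -addn1 !natrD smooth_evD IH smooth_ev1.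
Qed.
Lemma smooth_ev_sum I (r : seq I) (P : pred I) (E : I -> S) :
  (\sum_(i <- r | P i) E i) u = \sum_(i <- r | P i) E i u.
Proof. exact: (big_morph (fun f : S => f u) smooth_evD smooth_ev0). Qed.

Definition smooth_evE := (smooth_evD, smooth_evM, smooth_evN, smooth_evC,
  smooth_ev0, smooth_ev1, smooth_evn).

End Eval.

Lemma smooth_invertible f : (forall u, U u -> f u != 0) -> invertible f.
Proof.
move=> f0; exists (mk_smooth (smooth_closure_smooth oU (closure_inv (base f) f0))).
apply: smooth_ext => u Uu; rewrite smooth_evM // mk_smoothE // smooth_ev1 //.
by rewrite divff // f0.
Qed.

Lemma invertible_ev f u : invertible f -> U u -> f u != 0.
Proof.
case=> g fg Uu; apply/eqP => f0; have : (f * g) u = (1 : S) u by rewrite fg.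
by rewrite smooth_evM // f0 mul0r smooth_ev1 // => /esym/eqP; rewrite oner_eq0.
Qed.

Lemma smooth_sqrt f : (forall u, U u -> 0 < f u) ->
  exists2 g, g * g = f & forall u, U u -> g u = Num.sqrt (f u).
Proof.
move=> f0; pose g := mk_smooth (smooth_closure_smooth oU (closure_sqrt (base f) f0)).
have gE u : U u -> g u = Num.sqrt (f u) by move=> Uu; rewrite /g mk_smoothE.
exists g => //; apply: smooth_ext => u Uu.
by rewrite smooth_evM // gE // -expr2 sqr_sqrtr // ltW // f0.
Qed.

Lemma smooth_char0 k : invertible (k.+1%:R : S).
Proof. by apply: smooth_invertible => u Uu; rewrite smooth_evn // pnatr_eq0. Qed.

Lemma smooth_dE i f u : U u -> smooth_d i f u = partial i f u.
Proof. exact: svalP (d_sig i f) u. Qed.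

Lemma smooth_differentiable f u : U u -> differentiable f u.
Proof. by move=> Uu; apply: (smooth_valP f [::]). Qed.

Lemma smooth_d_derivation i : derivation (smooth_d i).
Proof.
have df f u : U u -> derivable f u (delta_mx 0 i).
  by move=> Uu; apply: diff_derivable; apply: smooth_differentiable.
split=> f g; apply: smooth_ext => u Uu; rewrite smooth_dE //.
  rewrite smooth_evD // !smooth_dE //.
  rewrite (partial_local oU i (k := (f : _ -> R^o) + (g : _ -> R^o)) Uu).
    by rewrite /partial deriveD //; apply: df.
  by move=> x Ux; rewrite smooth_evD.
rewrite smooth_evD // !smooth_evM // !smooth_dE //.
rewrite (partial_local oU i (k := (f : _ -> R^o) * (g : _ -> R^o)) Uu).
  rewrite /partial deriveM //; try exact: df.
  by rewrite /GRing.scale /= addrC; congr (_ + _); rewrite mulrC.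
by move=> x Ux; rewrite smooth_evM.
Qed.

Lemma smooth_d_cst i a : smooth_d i (smooth_cst a) = 0.
Proof.
apply: smooth_ext => u Uu; rewrite smooth_dE // smooth_ev0 //.
rewrite (partial_local oU i (k := fun=> a : R^o) Uu); first exact: derive_cst.
by move=> x Ux; rewrite smooth_evC.
Qed.

Lemma smooth_dC i j f : smooth_d i (smooth_d j f) = smooth_d j (smooth_d i f).
Proof.
apply: smooth_ext => u Uu.
have sf := smooth_valP f.
apply: etrans (smooth_dE i (smooth_d j f) Uu) _.
apply: etrans _ (esym (smooth_dE j (smooth_d i f) Uu)).
rewrite (partial_local oU i (k := partial j f) Uu); last by move=> x; apply: smooth_dE.
rewrite (partial_local oU j (k := partial i f) Uu); last by move=> x; apply: smooth_dE.
apply: clairaut.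
- near=> x; have Ux : U x by near: x; apply: open_nbhs_nbhs.
  by split; [apply: (sf [::])|apply: (sf [:: j])|apply: (sf [:: i])].
- by apply: differentiable_continuous; apply: (sf [:: i; j]).
- by apply: differentiable_continuous; apply: (sf [:: j; i]).
Unshelve. all: by end_near. Qed.

End SmoothRing.

(** * Positivity of the metric of the space form *)
Section Positivity.
Context {R : realType}.
Implicit Types (eps : R) (x v w : 'rV[R]_5).

Lemma sum_ord5 (E : 'I_5 -> R) :
  \sum_a E a = E 0 + (E 1 + (E 2%:R + (E 3%:R + E 4%:R))).
Proof.
rewrite !big_ord_recl big_ord0 addr0.
by do 4?[congr (_ + _)]; congr E; apply: val_inj.
Qed.

Lemma ip_ge0 eps v : 0 <= eps -> 0 <= ip eps v v ?= iff (v == 0).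
Proof.
move=> eps0; have ipE : ip eps v v = \sum_a v 0 a ^+ 2.
  by apply: eq_bigr => a _; rewrite ltNge eps0 mul1r expr2.
rewrite ipE; split; first by apply: sumr_ge0 => a _; apply: sqr_ge0.
rewrite eq_sym psumr_eq0 => [|a _]; last exact: sqr_ge0.
apply/allP/eqP => [v0|-> a _]; last by rewrite mxE expr0n /= eqxx.
apply/rowP => a; rewrite mxE; apply/eqP; rewrite -sqrf_eq0.
by have := v0 a (mem_index_enum _).
Qed.

Let lorentz_gt0 (a0 a1 a2 a3 a4 b0 b1 b2 b3 b4 eps : R) : eps < 0 ->
    [|| a0 != 0, a1 != 0, a2 != 0, a3 != 0 | a4 != 0] ->
    eps * (-1 * (b0 * b0) + (1 * (b1 * b1) + (1 * (b2 * b2) +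
      (1 * (b3 * b3) + 1 * (b4 * b4))))) = 1 ->
    -1 * (a0 * b0) + (1 * (a1 * b1) + (1 * (a2 * b2) +
      (1 * (a3 * b3) + 1 * (a4 * b4)))) = 0 ->
  0 < -1 * (a0 * a0) + (1 * (a1 * a1) + (1 * (a2 * a2) +
      (1 * (a3 * a3) + 1 * (a4 * a4)))).
Proof.
move=> eps0 a_neq0 epsb ab.
pose V := a1 ^+ 2 + a2 ^+ 2 + a3 ^+ 2 + a4 ^+ 2.
pose q := b1 ^+ 2 + b2 ^+ 2 + b3 ^+ 2 + b4 ^+ 2.
pose P := a1 * b1 + a2 * b2 + a3 * b3 + a4 * b4.
have sq (x : R) : 0 <= x ^+ 2 by exact: sqr_ge0.
have V0 : 0 <= V by rewrite /V !addr_ge0.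
have q0 : 0 <= q by rewrite /q !addr_ge0.
have abP : a0 * b0 = P by rewrite /P; lra.
have qb : q < b0 ^+ 2.
  rewrite -subr_gt0 -(nmulr_rlt0 _ eps0).
  have -> : eps * (b0 ^+ 2 - q) = - 1 by rewrite /q -epsb; ring.
  by rewrite ltrN10.
have CS : P ^+ 2 <= V * q.
  rewrite -subr_ge0.
  have -> : V * q - P ^+ 2 = (a1 * b2 - a2 * b1) ^+ 2 + (a1 * b3 - a3 * b1) ^+ 2
    + (a1 * b4 - a4 * b1) ^+ 2 + (a2 * b3 - a3 * b2) ^+ 2
    + (a2 * b4 - a4 * b2) ^+ 2 + (a3 * b4 - a4 * b3) ^+ 2.
    by rewrite /V /q /P; ring.
  by rewrite !addr_ge0.
have b0_gt0 : 0 < b0 ^+ 2 by apply: le_lt_trans qb.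
have VE : -1 * (a0 * a0) + (1 * (a1 * a1) + (1 * (a2 * a2) + (1 * (a3 * a3)
  + 1 * (a4 * a4)))) = V - a0 ^+ 2 by rewrite /V; ring.
rewrite VE -(pmulr_lgt0 _ b0_gt0).
have -> : (V - a0 ^+ 2) * b0 ^+ 2 = V * b0 ^+ 2 - P ^+ 2.
  by rewrite -abP; ring.
have [Vpos|Vle0] := ltP 0 V.
  rewrite subr_gt0; apply: le_lt_trans CS _.
  by rewrite ltr_pM2l.
have V00 : V = 0 by apply/eqP; rewrite eq_le Vle0.
have /and4P[/eqP z1 /eqP z2 /eqP z3 /eqP z4] :
    [&& a1 == 0, a2 == 0, a3 == 0 & a4 == 0].
  move/eqP: V00; rewrite /V !paddr_eq0 ?addr_ge0 // !sqrf_eq0.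
  by rewrite -!andbA.
move: a_neq0 abP b0_gt0; rewrite /P z1 z2 z3 z4 !mul0r !addr0 eqxx !orbF => a0_neq0.
by move=> /eqP; rewrite mulf_eq0 (negPf a0_neq0) /= => /eqP ->; rewrite expr0n ltxx.
Qed.

(** On the hyperboloid this is the reversed Cauchy-Schwarz inequality: the
    orthogonal complement of a timelike vector is spacelike. *)
Lemma ip_gt0 eps x v : space_form eps x -> tangent_space eps x v -> v != 0 ->
  0 < ip eps v v.
Proof.
move=> xN vT v0.
have [eps0|eps0] := leP 0 eps.
  by rewrite lt_neqAle !(ip_ge0 v eps0) v0.
move: xN vT; rewrite /space_form /tangent_space /= lt_eqF //.
move=> [epsx _]; rewrite /ip !sum_ord5 /= eps0 /= in epsx *.
move=> vx.
have v_neq0 : [|| v 0 0 != 0, v 0 1 != 0, v 0 2%:R != 0, v 0 3%:R != 0 | v 0 4%:R != 0].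
  apply: contraNT v0; rewrite !negb_or !negbK.
  move=> /and5P[/eqP z0 /eqP z1 /eqP z2 /eqP z3 /eqP z4].
  apply/eqP/rowP => a; rewrite mxE.
  by case: a => [[|[|[|[|[|//]]]]] la]; [rewrite -z0|rewrite -z1|rewrite -z2|
    rewrite -z3|rewrite -z4]; congr (v _ _); apply: val_inj.
move: (v 0 0) (v 0 1) (v 0 2%:R) (v 0 3%:R) (v 0 4%:R) v_neq0 vx.
move: (x 0 0) (x 0 1) (x 0 2%:R) (x 0 3%:R) (x 0 4%:R) epsx.
move=> b0 b1 b2 b3 b4 epsb a0 a1 a2 a3 a4 a_neq0 ab.
exact: (lorentz_gt0 eps0 a_neq0 epsb ab).
Qed.


End Positivity.

(** * From the geometry of a chart to the differential ring *)
Section Evaluation.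
Context {R : realType} {n : nat} {U : set 'rV[R]_n.+1} (oU : open U).
Local Notation S := (smooth_fun oU).
Implicit Types (u : 'rV[R]_n.+1) (f : S).

Definition ev m u (v : 'rV[S]_m) : 'rV[R]_m := map_mx (fun f : S => (f u : R)) v.

Section Point.
Variables (m : nat) (u : 'rV[R]_n.+1) (Uu : U u).
Implicit Types v w : 'rV[S]_m.

Lemma evD v w : ev u (v + w) = ev u v + ev u w.
Proof. by apply/rowP => k; rewrite !mxE smooth_evD. Qed.
Lemma evN v : ev u (- v) = - ev u v.
Proof. by apply/rowP => k; rewrite !mxE smooth_evN. Qed.
Lemma evZ f v : ev u (f *: v) = (f u : R) *: ev u v.
Proof. by apply/rowP => k; rewrite !mxE smooth_evM. Qed.
Lemma ev0 : ev u (0 : 'rV[S]_m) = 0.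
Proof. by apply/rowP => k; rewrite !mxE smooth_ev0. Qed.
Lemma ev_sum I (r : seq I) (P : pred I) (E : I -> 'rV[S]_m) :
  ev u (\sum_(i <- r | P i) E i) = \sum_(i <- r | P i) ev u (E i).
Proof. exact: (big_morph _ evD ev0). Qed.

End Point.

Lemma ev_ext m (v w : 'rV[S]_m) : (forall u, U u -> ev u v = ev u w) -> v = w.
Proof.
move=> vw; apply/rowP => k; apply: smooth_ext => u Uu.
by have /rowP/(_ k) := vw u Uu; rewrite !mxE.
Qed.

Lemma differentiable_row m (V : 'rV[R]_n.+1 -> 'rV[R]_m) u :
  (forall k, differentiable (fun x => V x 0 k : R^o) u) -> differentiable V u.
Proof.
move=> dV; have -> : V = \sum_k (fun x => (V x 0 k : R^o) *: delta_mx 0 k).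
  by apply/funext => x; rewrite fct_sumE -row_sum_delta.
by apply: differentiable_sum => k; apply: differentiableZl.
Qed.

Lemma ev_differentiable m (v : 'rV[S]_m) u : U u ->
  differentiable (fun x => ev x v) u.
Proof.
move=> Uu; apply: differentiable_row => k.
have -> : (fun x => ev x v 0 k : R^o) = smooth_val (v 0 k).
  by apply/funext => x; rewrite mxE.
exact: smooth_differentiable.
Qed.

Lemma ev_partial m i (v : 'rV[S]_m) u : U u ->
  partial i (fun x => ev x v) u = ev u (map_mx (smooth_d i) v).
Proof.
move=> Uu; rewrite /partial derive_mx; last exact/diff_derivable/ev_differentiable.
apply/rowP => k; rewrite !mxE; apply: etrans _ (esym (smooth_dE i (v 0 k) Uu)).
rewrite /partial; congr ('D_ _ _ u); apply/funext => x; by rewrite mxE.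
Qed.

Lemma rep_partial m i (V : 'rV[R]_n.+1 -> 'rV[R]_m) (v : 'rV[S]_m) u :
    (forall x, U x -> V x = ev x v) -> U u ->
  partial i V u = ev u (map_mx (smooth_d i) v).
Proof. by move=> VE Uu; rewrite (partial_local oU i Uu VE) ev_partial. Qed.

Lemma reps_partial i (h : 'rV[R]_n.+1 -> R) f u :
    (forall x, U x -> h x = f x) -> U u ->
  partial i (h : _ -> R^o) u = smooth_d i f u.
Proof.
move=> hE Uu; apply: etrans _ (esym (smooth_dE i f Uu)).
exact: (partial_local oU i Uu hE).
Qed.

Lemma ev_smooth_on m (v : 'rV[S]_m) : smooth_on U (fun u => ev u v).
Proof.
apply: (@smooth_on_coind _ _ _ oU _
  (fun V => exists v : 'rV[S]_m, V = fun u => ev u v)).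
- by move=> _ [w ->] u; apply: ev_differentiable.
- move=> _ i [w ->]; exists (fun u => ev u (map_mx (smooth_d i) w)).
    by exists (map_mx (smooth_d i) w).
  by move=> u; apply: ev_partial.
- by exists v.
Qed.

Lemma smooth_on_coord m (V : 'rV[R]_n.+1 -> 'rV[R]_m) k :
  smooth_on U V -> smooth_on U (fun u => V u 0 k : R^o).
Proof.
move=> sV; apply: (@smooth_on_coind _ _ _ oU _
  (fun h => exists2 W : 'rV[R]_n.+1 -> 'rV[R]_m,
    smooth_on U W & h = fun u => W u 0 k)).
- move=> _ [W sW ->] u Uu.
  apply: (@differentiable_comp _ _ _ _ W (fun y => y 0 k : R^o)).
    exact: (sW [::]).
  exact: differentiable_coord.
- move=> _ i [W sW ->]; exists (fun u => partial i W u 0 k).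
    by exists (partial i W) => //; apply: smooth_on_partial.
  move=> u Uu; rewrite /partial (derive_mx (M := W)) ?mxE //.
  by apply: diff_derivable; apply: (sW [::]).
- by exists V.
Qed.

Definition smooth_lift m (V : 'rV[R]_n.+1 -> 'rV[R]_m) (sV : smooth_on U V) :
    'rV[S]_m :=
  \row_k mk_smooth oU (smooth_on_coord k sV).

Lemma smooth_liftE m (V : 'rV[R]_n.+1 -> 'rV[R]_m) (sV : smooth_on U V) u :
  U u -> V u = ev u (smooth_lift sV).
Proof. by move=> Uu; apply/rowP => k; rewrite !mxE mk_smoothE. Qed.

End Evaluation.

(** Each coordinate expression evaluates, at the points of [U], to its counterpart
    over the ring of smooth functions. *)
Section ChartGeometry.
Context {R : realType} {U : set 'rV[R]_2} (oU : open U).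
Variables (eps : R) (F : 'rV[R]_2 -> 'rV[R]_5) (sF : smooth_on U F).

Local Notation S := (smooth_fun oU).
Local Notation d := (@smooth_d R 1 U oU).
Local Notation X := (smooth_lift oU sF).
Implicit Types (i j k l : 'I_2) (u : 'rV[R]_2) (v w : 'rV[S]_5).

Definition ssign (a : 'I_5) : S :=
  smooth_cst oU (if (eps < 0) && (a == 0) then -1 else 1).
Local Notation seps := (smooth_cst oU eps).
Local Notation shalf := (smooth_cst oU 2^-1).

Lemma ev_dot u v w : U u -> ip eps (ev u v) (ev u w) = dot ssign v w u.
Proof.
move=> Uu; rewrite /dot smooth_ev_sum //; apply: eq_bigr => a _.
by rewrite !smooth_evM // smooth_evC // !mxE.
Qed.

Lemma ev_vel i u : U u -> partial i F u = ev u (vel d X i).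
Proof. by move=> Uu; apply: rep_partial => // x Ux; apply: smooth_liftE. Qed.

Lemma ev_metric i j u : U u -> metric eps F u i j = gram ssign d X i j u.
Proof. by move=> Uu; rewrite mxE !ev_vel // ev_dot. Qed.

Variable c : 'I_2 -> 'I_2 -> S.
Hypothesis c_orthonormal : forall a b,
  \sum_i \sum_j c a i * c b j * gram ssign d X i j = (a == b)%:R.

Lemma ev_cometric i j u : U u -> cometric eps F u i j = igram c i j u.
Proof.
move=> Uu; pose B := \matrix_(i, j) (igram c i j u : R).
suff -> : cometric eps F u = B by rewrite mxE.
have gB : metric eps F u *m B = 1%:M.
  apply/matrixP => a b; rewrite !mxE.
  transitivity (((a == b)%:R : S) u : R); last by rewrite smooth_evn.
  rewrite -(gram_igram c_orthonormal) smooth_ev_sum //; apply: eq_bigr => k _.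
  by rewrite smooth_evM // ev_metric // [B _ _]mxE.
have [gU _] := mulmx1_unit gB.
by rewrite /cometric -[RHS](mulKmx gU) gB mulmx1.
Qed.

Lemma ev_christoffel k i j u : U u ->
  christoffel eps F k i j u = chris ssign d shalf X c k i j u.
Proof.
move=> Uu; rewrite /christoffel /chris smooth_evM // smooth_evC //.
congr (_ * _); rewrite smooth_ev_sum //; apply: eq_bigr => l _.
rewrite smooth_evM // ev_cometric //; congr (_ * _).
rewrite !smooth_evD // smooth_evN //.
by congr (_ + _ - _); apply: reps_partial => // x Ux; rewrite ev_metric.
Qed.

Lemma ev_cov i V v u : (forall x, U x -> V x = ev x v) -> U u ->
  pullback_nabla eps F i V u = ev u (cov ssign d seps X i v).
Proof.
move=> VE Uu; rewrite /pullback_nabla /tangent_proj /cov.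
rewrite (rep_partial i VE Uu) (smooth_liftE oU sF Uu) ev_dot //.
by rewrite evD // evN // evZ // smooth_evM // smooth_evC.
Qed.

Lemma ev_sff i j u : U u ->
  second_fundamental_form eps F i j u = ev u (sff ssign d seps shalf X c i j).
Proof.
move=> Uu; rewrite /second_fundamental_form /sff.
rewrite (ev_cov i (v := vel d X j)) //; last by move=> x; apply: ev_vel.
rewrite [RHS]evD // [X in _ = _ + X]evN // ev_sum //; congr (_ - _).
apply: eq_bigr => k _.
by rewrite evZ // ev_christoffel // ev_vel.
Qed.

Lemma ev_tension u : U u -> tension eps F u = ev u (tens ssign d seps shalf X c).
Proof.
move=> Uu; rewrite /tension /tens ev_sum //; apply: eq_bigr => i _.
rewrite ev_sum //; apply: eq_bigr => j _.
by rewrite evZ // ev_cometric // ev_sff.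
Qed.

Lemma ev_rough_laplacian V v u : (forall x, U x -> V x = ev x v) -> U u ->
  rough_laplacian eps F V u = ev u (rlap ssign d seps shalf X c v).
Proof.
move=> VE Uu; rewrite /rough_laplacian /rlap evN // ev_sum //; congr (- _).
apply: eq_bigr => i _; rewrite ev_sum //; apply: eq_bigr => j _.
rewrite evZ // ev_cometric //; congr (_ *: _).
rewrite (ev_cov i (v := cov ssign d seps X j v)) //; last first.
  by move=> x; apply: ev_cov.
rewrite [RHS]evD // [X in _ = _ + X]evN // ev_sum //; congr (_ - _).
apply: eq_bigr => k _; by rewrite evZ // ev_christoffel // (ev_cov k VE).
Qed.

Lemma ev_bitension u : U u ->
  bitension eps F u = ev u (bitens ssign d seps shalf X c).
Proof.
move=> Uu; rewrite /bitension /bitens.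
rewrite (ev_rough_laplacian (v := tens ssign d seps shalf X c)) //; last first.
  by move=> x; apply: ev_tension.
rewrite [RHS]evD // [X in _ = _ + X]evN // [X in _ = X + _]evN // ev_sum //.
congr (_ - _).
apply: eq_bigr => i _; rewrite ev_sum //; apply: eq_bigr => j _.
rewrite evZ // ev_cometric //; congr (_ *: _).
rewrite /space_form_curvature evZ // smooth_evC // evD // evN // !evZ //.
by rewrite -!ev_dot // !ev_vel // ev_tension.
Qed.

Lemma ev_mean_curvature_vector u : U u ->
  mean_curvature_vector eps F u = ev u (shalf *: tens ssign d seps shalf X c).
Proof.
by move=> Uu; rewrite evZ // smooth_evC // /mean_curvature_vector ev_tension.
Qed.

Lemma ev_normal_nabla i V v u : (forall x, U x -> V x = ev x v) -> U u ->
  normal_nabla eps F i V u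
  = ev u (nproj ssign d X c (cov ssign d seps X i v)).
Proof.
move=> VE Uu; rewrite /normal_nabla /normal_proj (ev_cov i VE) // /nproj.
rewrite [RHS]evD // [X in _ = _ + X]evN // ev_sum //; congr (_ - _).
apply: eq_bigr => k _; rewrite ev_sum //; apply: eq_bigr => l _.
by rewrite evZ // smooth_evM // ev_cometric // !ev_vel // ev_dot.
Qed.

End ChartGeometry.

(** * Immersed surfaces in a chart *)

Section ImmersedChart.
Context {R : realType} {U : set 'rV[R]_2} (oU : open U).
Variables (eps : R) (F : 'rV[R]_2 -> 'rV[R]_5) (sF : smooth_on U F).
Hypotheses (FN : forall u, U u -> space_form eps (F u))
  (Finj : forall u, U u -> injective ('d F u)).

Local Notation S := (smooth_fun oU).
Local Notation d := (@smooth_d R 1 U oU).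
Local Notation X := (smooth_lift oU sF).
Local Notation sg := (ssign oU eps).
Local Notation seps := (smooth_cst oU eps).
Local Notation shalf := (smooth_cst oU 2^-1).
Local Notation velX := (vel d X).
Local Notation gramX := (gram sg d X).
Implicit Types (i j k l : 'I_2) (u : 'rV[R]_2) (v w : 'rV[S]_5).

Lemma ipZr e (a : R) (v w : 'rV[R]_5) : ip e v (a *: w) = a * ip e v w.
Proof.
rewrite mulr_sumr; apply: eq_bigr => b _; rewrite !mxE.
by ring.
Qed.

(** Normal field of the space form in [R^5]. The position vector does not serve
    when [eps = 0], since it then lies in the hyperplane. *)
Definition ambient_normal : 'rV[S]_5 :=
  if eps == 0 then \row_a smooth_cst oU (a == 0)%:R else X.
Local Notation nu := ambient_normal.
(** The factor in [d nu = kap dX]. *)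
Definition curved : S := smooth_cst oU (eps != 0)%:R.
Local Notation kap := curved.

Let dsg i a : d i (sg a) = 0. Proof. exact: smooth_d_cst. Qed.
Let dd i : derivation (d i). Proof. exact: smooth_d_derivation. Qed.
Let ev_X u : U u -> ev u X = F u.
Proof. by move=> Uu; rewrite -smooth_liftE. Qed.

(** The two cases of the tangent space of the space form become a single linear
    equation. *)
Lemma tangent_spaceE u v : U u ->
  tangent_space eps (F u) (ev u v) <-> dot sg v nu u = 0.
Proof.
move=> Uu; rewrite -ev_dot // /tangent_space /nu /=.
have [eps0|eps0] := eqVneq eps 0; last by rewrite ev_X.
rewrite /ip (bigD1 0) //= big1 => [|a a0].
  by rewrite eps0 ltxx /= !mxE smooth_evC // eqxx mulr1 mul1r addr0.
by rewrite [ev u (\row_b _) 0 a]mxE mxE smooth_evC // (negPf a0) !mulr0.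
Qed.

(* All properties of [nu] follow from this dichotomy. *)
Let eps_cases : eps = 0 /\ nu = (\row_a smooth_cst oU (a == 0)%:R) /\ kap = 0
   /\ seps = 0 \/ [/\ eps != 0, nu = X, kap = 1 & invertible seps].
Proof.
rewrite /ambient_normal /curved.
have [eps0|eps0] := eqVneq eps 0; [left|right].
  have cst0 : smooth_cst oU 0 = 0.
    by apply: smooth_ext => u Uu; rewrite smooth_evC // smooth_ev0.
  by rewrite cst0 eps0 cst0; do !split.
split; [by []|by []| |].
  by apply: smooth_ext => u Uu; rewrite smooth_evC // smooth_ev1.
by apply: smooth_invertible => u Uu; rewrite smooth_evC.
Qed.

Let X00 : eps = 0 -> X 0 0 = 0.
Proof.
move=> eps0; apply: smooth_ext => u Uu; rewrite smooth_ev0 //.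
have := FN Uu; rewrite /space_form /= eps0 eqxx -ev_X //.
by rewrite mxE.
Qed.

Let XX : eps != 0 -> seps * dot sg X X = 1.
Proof.
move=> eps0; apply: smooth_ext => u Uu.
rewrite smooth_evM // smooth_evC // -ev_dot // ev_X // smooth_ev1 //.
by have := FN Uu; rewrite /space_form /= (negPf eps0) => -[].
Qed.

Lemma d_ambient_normal i : map_mx (d i) nu = kap *: velX i.
Proof.
case: eps_cases => [[_ [-> [-> _]]]|[_ -> -> _]]; last by rewrite scale1r.
by rewrite scale0r; apply/rowP => a; rewrite !mxE smooth_d_cst.
Qed.

Lemma eps_ambient_normal : seps *: X = seps *: nu.
Proof. by case: eps_cases => [[_ [_ [_ ->]]]|[_ -> _ _]]; rewrite ?scale0r. Qed.

Lemma dot_ambient_normal0 v : eps = 0 -> dot sg v nu = v 0 0.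
Proof.
move=> eps0; have -> : nu = \row_a smooth_cst oU (a == 0)%:R.
  by rewrite /ambient_normal eps0 eqxx.
apply: smooth_ext => u Uu.
rewrite -ev_dot // /ip (bigD1 0) //= big1 => [|a a0].
  by rewrite eps0 ltxx /= !mxE smooth_evC // eqxx mulr1 mul1r addr0.
by rewrite [ev u (\row_b _) 0 a]mxE mxE smooth_evC // (negPf a0) !mulr0.
Qed.

Lemma vel_ambient_normal i : dot sg (velX i) nu = 0.
Proof.
case: eps_cases => [[eps0 _]|[eps0 -> _ epsI]].
  by rewrite dot_ambient_normal0 // mxE X00 // (der0 (dd i)).
apply: (invertible_cancel0 (smooth_char0 oU 1)).
apply: (invertible_cancel0 epsI).
have := congr1 (d i) (XX eps0).
rewrite (derM (dd i)) smooth_d_cst (der_dot (dd i)) // (der1 (dd i)).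
rewrite (dotC _ X) => E; apply: (lin_comb1 (c := 1) E); rewrite /vel; ring.
Qed.

Lemma eps_curved : seps * kap = seps.
Proof. by case: eps_cases => [[_ [_ [_ ->]]]|[_ _ -> _]]; rewrite ?mul0r ?mulr1. Qed.

Lemma eps_ambient_normal2 : seps * dot sg nu nu = kap.
Proof.
case: eps_cases => [[_ [_ [-> ->]]]|[eps0 -> -> _]]; first by rewrite mul0r.
exact: XX.
Qed.

Lemma ambient_normal_invertible : invertible (dot sg nu nu).
Proof.
case: eps_cases => [[eps0 [nuE _]]|[eps0 -> _ _]].
  rewrite dot_ambient_normal0 // nuE mxE; exists 1; rewrite mulr1.
  by apply: smooth_ext => u Uu; rewrite smooth_evC // smooth_ev1.
by exists seps; rewrite mulrC XX.
Qed.

Lemma tangent_gt0 u v : U u -> dot sg v nu u = 0 -> ev u v != 0 ->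
  0 < dot sg v v u.
Proof.
move=> Uu vnu v0; rewrite -ev_dot //; apply: ip_gt0 (FN Uu) _ v0.
exact/tangent_spaceE.
Qed.

Lemma tangent_anisotropic v w : dot sg v nu = 0 ->
  invertible (dot sg v w) -> invertible (dot sg v v).
Proof.
move=> vnu vwI; apply: smooth_invertible => u Uu; rewrite gt_eqF //.
apply: tangent_gt0 => //; first by rewrite vnu smooth_ev0.
apply/eqP => v0; have := invertible_ev vwI Uu.
rewrite -ev_dot // v0 /ip big1 ?eqxx // => a _.
by rewrite mxE mul0r mulr0.
Qed.

Let dot_comb2 (a b : S) v w :
  dot sg (a *: v + b *: w) (a *: v + b *: w)
  = a * a * dot sg v v + 2 * (a * b) * dot sg v w + b * b * dot sg w w.
Proof. by rewrite !dotE (dotC _ w v); ring. Qed.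

(** The quadratic form is the squared norm of the tangent vector with coordinates
    [a] and [b], which is nonzero because [F] is an immersion. *)
Lemma gram_gt0 u (a b : R) : U u -> (a != 0) || (b != 0) ->
  0 < a * a * gramX 0 0 u + 2 * (a * b) * gramX 0 1 u + b * b * gramX 1 1 u.
Proof.
move=> Uu ab.
pose w := smooth_cst oU a *: velX 0 + smooth_cst oU b *: velX 1.
have -> : a * a * gramX 0 0 u + 2 * (a * b) * gramX 0 1 u + b * b * gramX 1 1 u
    = dot sg w w u.
  rewrite /w dot_comb2 /gram.
  move: (dot sg _ _) (dot sg _ _) (dot sg _ _) => g00 g01 g11.
  by rewrite !(smooth_evE oU Uu).
apply: tangent_gt0 => //.
  by rewrite /w dotDl !dotZl !vel_ambient_normal !mulr0 addr0 smooth_ev0.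
rewrite /w (evD Uu) !(evZ Uu) !(smooth_evC oU Uu) -!(ev_vel oU sF _ Uu).
have dF : differentiable F u by apply: (sF [::]).
rewrite /partial !deriveE // -!linearZ -linearD.
apply: contraTneq ab => w0.
have /rowP z : a *: delta_mx 0 0 + b *: delta_mx 0 1 = 0 :> 'rV[R]_2.
  by apply: (Finj Uu); rewrite w0 linear0.
move: (z 0) (z 1); rewrite !mxE /= mulr1 !mulr0 addr0 add0r mulr1 => -> ->.
by rewrite eqxx.
Qed.

Lemma exists_frame (q : 'I_2 -> S) :
    (forall u, U u -> (q 0 u != 0) || (q 1 u != 0)) ->
  exists c : 'I_2 -> 'I_2 -> S,
    [/\ forall a b, \sum_i \sum_j c a i * c b j * gramX i j = (a == b)%:R,
      \sum_i c 1 i * q i = 0 & invertible (\sum_i c 0 i * q i)].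
Proof.
move=> q0.
have sqrtP (f : S) : (forall u, U u -> 0 < f u) ->
    exists2 g : S, g * g = f & invertible g.
  move=> f0; have [g gg gE] := smooth_sqrt f0; exists g => //.
  by apply: smooth_invertible => u Uu; rewrite gE // gt_eqF // sqrtr_gt0 f0.
have [u Uu|delta delta2 deltaI] :=
    sqrtP (gramX 0 0 * gramX 1 1 - gramX 0 1 * gramX 0 1).
  have g00 : 0 < gramX 0 0 u.
    have := @gram_gt0 u 1 0 Uu; rewrite oner_eq0 => /(_ isT).
    by rewrite !(mulr0, mul0r, mulr1, mul1r, addr0).
  have := @gram_gt0 u (- gramX 0 1 u) (gramX 0 0 u) Uu.
  rewrite (gt_eqF g00) orbT => /(_ isT).
  move: (gramX 0 0) (gramX 0 1) (gramX 1 1) g00.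
  move=> g00 g01 g11 g00_gt0; rewrite !(smooth_evE oU Uu) => Q.
  rewrite -(pmulr_rgt0 _ g00_gt0); apply: lt_le_trans Q _.
  by rewrite le_eqVlt; apply/orP; left; apply/eqP; ring.
have [u Uu|m m2 mI] := sqrtP (gramX 0 0 * q 1 * q 1 - 2 * gramX 0 1 * q 0 * q 1
    + gramX 1 1 * q 0 * q 0).
  have := @gram_gt0 u (- q 1 u) (q 0 u) Uu.
  rewrite oppr_eq0 orbC => /(_ (q0 u Uu)).
  move: (gramX 0 0) (gramX 0 1) (gramX 1 1) (q 0) (q 1) => g00 g01 g11 q0' q1'.
  rewrite !(smooth_evE oU Uu) => Q; apply: lt_le_trans Q _.
  by rewrite le_eqVlt; apply/orP; left; apply/eqP; ring.
by apply: frame_along delta2 m2 deltaI mI => i j; apply: dotC.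
Qed.

End ImmersedChart.

Section BiharmonicChart.
Context {R : realType} {U : set 'rV[R]_2} (oU : open U).
Variables (eps : R) (F : 'rV[R]_2 -> 'rV[R]_5) (sF : smooth_on U F).
Hypotheses (FN : forall u, U u -> space_form eps (F u))
  (Finj : forall u, U u -> injective ('d F u)).
Local Notation f := (mean_curvature eps F).
Hypotheses
  (H_neq0 : forall u, U u -> mean_curvature_vector eps F u <> 0)
  (grad_neq0 : forall u, U u -> grad eps F f u <> 0)
  (A3_grad : forall u, U u ->
     grad eps F f u *m A3 eps F u = (2 * f u) *: grad eps F f u)
  (flat : forall eta, smooth_normal_section eps F U eta ->
     forall i j u, U u ->
       normal_nabla eps F i (normal_nabla eps F j eta) u
       = normal_nabla eps F j (normal_nabla eps F i eta) u)
  (bih : forall u, U u -> bitension eps F u = 0).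

Local Notation S := (smooth_fun oU).
Local Notation d := (@smooth_d R 1 U oU).
Local Notation X := (smooth_lift oU sF).
Local Notation sg := (ssign oU eps).
Local Notation seps := (smooth_cst oU eps).
Local Notation shalf := (smooth_cst oU 2^-1).
Local Notation nu := (ambient_normal oU eps sF).
Local Notation gramX := (gram sg d X).
Implicit Types (i j k l : 'I_2) (u : 'rV[R]_2) (v w : 'rV[S]_5).

Let dsg i a : d i (sg a) = 0. Proof. exact: smooth_d_cst. Qed.
Let dd i : derivation (d i). Proof. exact: smooth_d_derivation. Qed.
Let dC i j x : d i (d j x) = d j (d i x). Proof. exact: smooth_dC. Qed.
Let deps i : d i seps = 0. Proof. exact: smooth_d_cst. Qed.
Let half2 : 2 * shalf = 1 :> S.
Proof.
apply: smooth_ext => u Uu.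
by rewrite smooth_evM // smooth_evn // smooth_evC // smooth_ev1 // divff ?pnatr_eq0.
Qed.

(** The frame is built from the differential of the mean curvature, and the mean
    curvature is a smooth function because it can be computed in some other
    frame. *)
Lemma biharmonic_chart_absurd : 1 = 0 :> S.
Proof.
have dnu := d_ambient_normal oU eps sF.
have epsX := eps_ambient_normal oU eps sF.
have velnu := vel_ambient_normal oU sF FN.
have epskap := eps_curved oU eps sF.
have epsnu := eps_ambient_normal2 oU sF FN.
(* An arbitrary frame, here adapted to the first coordinate. *)
have [u Uu|c0 [c0_orth _ _]] :=
    @exists_frame _ _ oU _ _ sF FN Finj (fun i => (i == 0)%:R).
  by rewrite (smooth_ev1 oU Uu) oner_eq0.
have HE0 u := ev_mean_curvature_vector c0_orth (u := u).
move defH0: (shalf *: tens sg d seps shalf X c0) => H0 in HE0.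
have H0nu : dot sg H0 nu = 0.
  rewrite -defH0 dotZl.
  by rewrite (tens_nu dd dC dsg half2 dnu epsX velnu epskap epsnu c0_orth) mulr0.
have s_gt0 u : U u -> 0 < dot sg H0 H0 u.
  move=> Uu; apply: (tangent_gt0 (sF := sF) FN Uu).
    by rewrite H0nu (smooth_ev0 oU Uu).
  by rewrite -(HE0 u Uu); apply/eqP/H_neq0.
have [fS ff fSE] := smooth_sqrt s_gt0.
have fE u : U u -> f u = fS u.
  by move=> Uu; rewrite fSE // /mean_curvature HE0 // (ev_dot _ _ _ Uu).
have f_gt0 u : U u -> 0 < fS u by move=> Uu; rewrite fSE // sqrtr_gt0 s_gt0.
have dfE i u : U u -> partial i (f : _ -> R^o) u = d i fS u.
  by move=> Uu; exact: (@reps_partial R 1 U oU i f fS u fE Uu).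
have [u Uu|c [c_orth c1q c0q]] :=
    @exists_frame _ _ oU _ _ sF FN Finj (fun i => d i fS).
  rewrite -negb_and; apply/negP => /andP[/eqP d0 /eqP d1].
  case: (grad_neq0 Uu); apply/rowP => k; rewrite !mxE sum_ord2 !(dfE _ _ Uu).
  by rewrite d0 d1 !mul0r addr0.
have HE u := ev_mean_curvature_vector c_orth (u := u).
move defH: (shalf *: tens sg d seps shalf X c) => H in HE.
have HH0 : H = H0.
  by apply: ev_ext => u Uu; exact: etrans (esym (HE u Uu)) (HE0 u Uu).
have sE : dot sg H H = fS * fS by rewrite HH0 ff.
have fI : invertible fS by apply: smooth_invertible => u Uu; rewrite gt_eqF ?f_gt0.
have DsE a : Dframe d c a (dot sg H H) = 2 * fS * \sum_i c a i * d i fS.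
  rewrite sE /Dframe mulr_sumr; apply: eq_bigr => i _.
  by rewrite (derM (dd i)); ring.
have Hvel i : dot sg H (vel d X i) = 0.
  by rewrite -defH dotZl (tens_vel dd dC dsg half2 epsX velnu c_orth) mulr0.
have Hnu : dot sg H nu = 0 by rewrite HH0.
have H_normal : smooth_normal_section eps F U (mean_curvature_vector eps F).
  split.
    apply: (smooth_on_local oU (h := fun u => ev u H)); last exact: ev_smooth_on.
    by move=> u Uu; rewrite HE.
  move=> u Uu; rewrite HE //; split.
    by apply: (tangent_spaceE eps sF H Uu).2; rewrite Hnu (smooth_ev0 oU Uu).
  by move=> i; rewrite (ev_vel oU sF i Uu) (ev_dot _ _ _ Uu) Hvel (smooth_ev0 oU Uu).
have nablaH i u : U u -> normal_nabla eps F i (mean_curvature_vector eps F) u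
    = ev u (nproj sg d X c (cov sg d seps X i H)).
  by move=> Uu; exact: (ev_normal_nabla c_orth i HE Uu).
have nabla2H i j u : U u ->
    normal_nabla eps F i (normal_nabla eps F j (mean_curvature_vector eps F)) u
    = ev u (nproj sg d X c (cov sg d seps X i
        (nproj sg d X c (cov sg d seps X j H)))).
  by move=> Uu; exact: (ev_normal_nabla c_orth i (@nablaH j) Uu).
apply: (surface_absurd dd dC dsg deps half2 dnu epsX velnu epskap epsnu c_orth);
  rewrite ?defH.
- exact: smooth_char0.
- exact: (tangent_anisotropic (sF := sF) FN).
- exact: (ambient_normal_invertible oU sF FN).
- by rewrite sE; apply: invertibleM.
- rewrite DsE; apply: invertibleM c0q; apply: invertibleM fI.
  exact: (smooth_char0 oU 1).
- by rewrite DsE c1q mulr0.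
- have [p pE] : {p : S | \sum_i c 0 i * d i fS = p} by eexists.
  have [b bE] : {b : 'I_2 -> 'I_2 -> S |
      forall i j, dot sg (sff sg d seps shalf X c i j) H = b i j}.
    by exists (fun i j => dot sg (sff sg d seps shalf X c i j) H).
  have [G GE] : {G : 'I_2 -> 'I_2 -> S | forall i j, igram c i j = G i j}.
    by exists (igram c).
  move=> k.
  have -> : \sum_i \sum_j
      c 0 i * dot sg (sff sg d seps shalf X c i j) H * igram c j k
      = \sum_i c 0 i * \sum_j b i j * G j k.
    apply: eq_bigr => i _; rewrite mulr_sumr; apply: eq_bigr => j _.
    by rewrite bE GE mulrA.
  rewrite sE; apply: smooth_ext => u Uu.
  have grad_frame l : grad eps F f u 0 l = p u * c 0 l u.
    have qG : p * c 0 l = \sum_i d i fS * igram c i l.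
      rewrite -pE; apply: (lin_comb1 (c := - c 1 l) c1q).
      by rewrite /igram !sum_ord2; ring.
    rewrite -(smooth_evM Uu) qG mxE (smooth_ev_sum Uu); apply: eq_bigr => i _.
    by rewrite (dfE _ _ Uu) (smooth_evM Uu) (ev_cometric c_orth _ _ Uu).
  have shape_frame i l : A3 eps F u i l = (fS u)^-1 * (\sum_j b i j * G j l) u.
    rewrite mxE (smooth_ev_sum Uu) mulr_sumr; apply: eq_bigr => j _.
    rewrite (ev_cometric c_orth _ _ Uu) /E3 ipZr (fE u Uu) (HE u Uu).
    by rewrite (ev_sff c_orth _ _ Uu) (ev_dot _ _ _ Uu) bE GE (smooth_evM Uu) mulrA.
  have : \sum_i grad eps F f u 0 i * A3 eps F u i k = 2 * f u * grad eps F f u 0 k.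
    by have /rowP/(_ k) := A3_grad Uu; rewrite [LHS]mxE [RHS]mxE.
  have p_neq0 : p u != 0 by rewrite -pE; apply: invertible_ev.
  have f_neq0 : fS u != 0 by apply: invertible_ev.
  rewrite (fE u Uu) (smooth_ev_sum Uu) (grad_frame k).
  under eq_bigr do rewrite grad_frame shape_frame mulrCA -(mulrA (p u)).
  rewrite -!mulr_sumr.
  under [in X in _ -> X]eq_bigr do rewrite (smooth_evM Uu).
  move: (\sum_i _) => w E.
  rewrite !(smooth_evE oU Uu); move: E p_neq0 f_neq0.
  move: (p u) (fS u) (c 0 k u) => x y z E x_neq0 y_neq0.
  apply: (mulfI x_neq0); apply: (mulfI (invr_neq0 y_neq0)).
  by rewrite E; field.
- apply: ev_ext => u Uu; apply: etrans (esym (nabla2H 0 1 u Uu)) _.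
  exact: etrans (flat H_normal 0 1 Uu) (nabla2H 1 0 u Uu).
- apply: ev_ext => u Uu; rewrite -(ev_bitension c_orth Uu) bih //.
  by rewrite (ev0 oU _ Uu).
Qed.

End BiharmonicChart.

Theorem theorem4p2 (R : realType) (eps : R) (M : topologicalType)
    (A : set (chart R M)) (phi : M -> 'rV[R]_5)
    (surfaceM : connected_surface A)
    (immersion_phi : immersion eps A phi)
    (non_cmc_phi : non_cmc eps A phi)
    (W_phi : W_surface eps A phi)
    (flat_phi : flat_normal_bundle eps A phi)
    (curvature_neq0 : everywhere A phi (fun F u =>
       3 * mean_curvature eps F u ^+ 2 + gauss_curvature eps F u - eps <> 0))
    (nabla_E3_neq0 : everywhere A phi (fun F u =>
       exists i, normal_nabla eps F i (E3 eps F) u <> 0))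
    (A3_grad : everywhere A phi (fun F u =>
       let f := mean_curvature eps F in
       grad eps F f u *m A3 eps F u = (2 * f u) *: grad eps F f u)) :
  ~ biharmonic eps A phi.
Proof.
move=> bih.
have [[x _] _ _ _ [cover _]] := surfaceM.
have [c Ac cx] := cover x.
have [phiN /(_ c Ac)[sF Finj]] := immersion_phi.
have Uu := cmap_img cx; have oU : open (cimg c) := @cimg_open R M c.
have := @biharmonic_chart_absurd R (cimg c) oU eps (phi \o cinv c) sF
  (fun u _ => phiN _) Finj
  (fun u Uu => let: And3 H0 _ _ := non_cmc_phi c Ac u Uu in H0)
  (fun u Uu => let: And3 _ g0 _ := non_cmc_phi c Ac u Uu in g0)
  (A3_grad c Ac) (flat_phi c Ac) (bih c Ac).
move=> /(congr1 (fun f : smooth_fun oU => f (cmap c x))).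
rewrite (smooth_ev1 oU Uu) (smooth_ev0 oU Uu).
by move/eqP; rewrite oner_eq0.
Qed.
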